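(* Let $\Gamma$ be an extension of a finitely generated free group by a (finite or infinite) cyclic group, i.e. there is a short exact sequence $1\to F\to\Gamma\to C\to 1$ with $F$ a finitely generated free group and $C$ a cyclic group. Then $\Gamma$ has a box space which embeds coarsely into Hilbert space; that is, there is a nested sequence $\{K_i\}$ of finite index normal subgroups of $\Gamma$ with trivial intersection such that $\Box_{\{K_i\}}\Gamma$ embeds coarsely into Hilbert space.
   Context: Coarse embedding: a metric space $(X,d_X)$ embeds coarsely in $(Y,d_Y)$ if there are a map $F:X\to Y$ and non-decreasing functions $\rho_\pm:\mathbb{R}_+\to\mathbb{R}_+$ with $\lim_{t\to\infty}\rho_\pm(t)=\infty$ and $\rho_-(d_X(x,x'))\le d_Y(F(x),F(x'))\le \rho_+(d_X(x,x'))$ for all $x,x'\in X$. Box space: let $\Gamma$ be a finitely generated residually finite group with a fixed finite generating set, and $\{K_i\}$ a nested sequence ($K_1\supseteq K_2\supseteq\cdots$) of finite index normal subgroups with trivial intersection. The box space $\Box_{\{K_i\}}\Gamma$ is the disjoint union $\sqcup_i \Gamma/K_i$, where each $\Gamma/K_i$ carries the word metric $d_i$ given by the image of the generating set of $\Gamma$, the distance $d(e_i,e_{i+1})$ between the identity elements $e_i\in\Gamma/K_i$ and $e_{i+1}\in \Gamma/K_{i+1}$ is chosen greater than the maximum of the diameters of $\Gamma/K_i$ and $\Gamma/K_{i+1}$, and for $\alpha\in\Gamma/K_i$, $\beta\in\Gamma/K_j$ with $i<j$ one sets $d(\alpha,\beta)=d_i(\alpha,e_i)+\sum_{k=i}^{j-1}d(e_k,e_{k+1})+d_j(e_j,\beta)$.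 *)

(* Defs.v *)
From HB Require Import structures.
From mathcomp Require Import all_boot all_order all_algebra.
From mathcomp Require Import all_classical all_reals.
From mathcomp Require Import topology normedtype sequences.

Set Implicit Arguments.
Unset Strict Implicit.
Unset Printing Implicit Defensive.

Import Order.TTheory GRing.Theory Num.Theory.
Import numFieldNormedType.Exports.

Local Open Scope classical_set_scope.
Local Open Scope ring_scope.
Local Open Scope quotient_scope.

Section Words.
Context {G : groupType}.

Definition is_word (S w : seq G) : Prop :=
  {in w, forall s, (s \in S) \/ (s^-1%g \in S)}.

Definition generates (S : seq G) : Prop :=
  forall x : G, exists2 w, is_word S w & x = (\prod_(s <- w) s)%g.

(* The default value 0 of [xget] is only reached when x is not a product of
   elements of S and their inverses. *)
Definition word_length (S : seq G) (x : G) : nat :=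
  let lengths := [set n | exists2 w, is_word S w /\ size w = n
                                   & x = (\prod_(s <- w) s)%g] in
  xget 0%N [set n | lengths n /\ forall m, lengths m -> (n <= m)%N].

Definition word_dist (R : realType) (S : seq G) (x y : G) : R :=
  (word_length S (x^-1 * y)%g)%:R.

End Words.

Definition finitely_generated (G : groupType) : Prop :=
  exists S : seq G, generates S.

Definition cyclic_group (G : groupType) : Prop :=
  exists c : G, forall x, exists n : nat, x = (c ^+ n)%g \/ x = (c ^- n)%g.

(* F is free on its subset X: every map X -> H extends uniquely to a morphism.
   The values of f outside X play no role. *)
Definition free_on (F : groupType) (X : set F) : Prop :=
  forall (H : groupType) (f : F -> H),
    exists h : {multiplicative F -> H},
      (forall x, X x -> h x = f x) /\
      (forall h' : {multiplicative F -> H},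
         (forall x, X x -> h' x = f x) -> h' =1 h).

Definition free_group (F : groupType) : Prop := exists X : set F, free_on X.

Definition short_exact (F G C : groupType)
    (i : {multiplicative F -> G}) (p : {multiplicative G -> C}) : Prop :=
  [/\ injective i, range i = [set g | p g = 1%g] & range p = [set: C]].

HB.mixin Record isConjClosed (G : groupType) (S : {pred G}) := {
  conj_closed_subproof : forall x y : G, x \in S -> (x ^ y)%g \in S
}.

#[short(type="normalSubgroup")]
HB.structure Definition NormalSubgroup (G : groupType) :=
  {S of GroupClosed G S & isConjClosed G S}.

Section Quotient.
Variables (G : groupType) (N : normalSubgroup G).
Implicit Types x y z : G.

Lemma normal1 : 1%g \in N. Proof. exact: gpred1. Qed.
Lemma normalM x y : x \in N -> y \in N -> (x * y)%g \in N.
Proof. exact: gpredM. Qed.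
Lemma normalV x : x \in N -> (x^-1)%g \in N.
Proof. by move=> xN; rewrite gpredV. Qed.
Lemma normalJ x y : x \in N -> (x ^ y)%g \in N.
Proof. exact: conj_closed_subproof. Qed.

Definition coset_rel x y : bool := (x^-1 * y)%g \in N.

Lemma coset_rel_equiv : equiv_class_of coset_rel.
Proof.
have sym x y : coset_rel x y -> coset_rel y x.
  by move=> /normalV; rewrite invgM invgK.
split=> [x|x y|y x z]; first by rewrite /coset_rel mulVg normal1.
- by apply/idP/idP; exact: sym.
- move=> xy yz; have := normalM xy yz.
  by rewrite /coset_rel -mulgA mulVKg.
Qed.

Canonical coset_equiv := EquivRelPack coset_rel_equiv.
Canonical coset_encModRel := defaultEncModRel coset_rel.

Definition quotient := {eq_quot coset_rel}.

HB.instance Definition _ : EqQuotient G coset_rel quotient :=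
  EqQuotient.on quotient.
HB.instance Definition _ := Choice.on quotient.

Definition quotient_one : quotient := lift_cst quotient 1%g.
Definition quotient_mul := lift_op2 quotient ( *%g : G -> G -> G).
Definition quotient_inv := lift_op1 quotient (fun x : G => x^-1%g).

Canonical pi_one_morph := PiConst quotient_one.

Lemma coset_relE x y : coset_rel x y = (x == y %[mod quotient]).
Proof. by rewrite piE. Qed.

Lemma pi_inv : {morph \pi : x / x^-1%g >-> quotient_inv x}.
Proof.
move=> x; unlock quotient_inv; apply/eqP; rewrite -coset_relE /coset_rel.
set r := repr _.
have rx : coset_rel r x by rewrite coset_relE reprK.
by have := normalJ r^-1%g rx; rewrite /conjg !mulgA mulVg mul1g invgK.
Qed.
Canonical pi_inv_morph := PiMorph1 pi_inv.

Lemma pi_mul : {morph \pi : x y / (x * y)%g >-> quotient_mul x y}.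
Proof.
move=> x y; unlock quotient_mul; apply/esym/eqP; rewrite -coset_relE /coset_rel.
set x' := repr _; set y' := repr _.
have xx' : coset_rel x' x by rewrite coset_relE reprK.
have yy' : coset_rel y' y by rewrite coset_relE reprK.
have := normalM yy' (normalJ y xx').
by rewrite /conjg invgM !mulgA mulgK.
Qed.
Canonical pi_mul_morph := PiMorph2 pi_mul.

Lemma quotient_mulA : associative quotient_mul.
Proof.
by move=> x y z; rewrite -[x]reprK -[y]reprK -[z]reprK !piE mulgA.
Qed.
Lemma quotient_mul1 : left_id quotient_one quotient_mul.
Proof. by move=> x; rewrite -[x]reprK !piE mul1g. Qed.
Lemma quotient_mulr1 : right_id quotient_one quotient_mul.
Proof. by move=> x; rewrite -[x]reprK !piE mulg1. Qed.
Lemma quotient_mulV : left_inverse quotient_one quotient_inv quotient_mul.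
Proof. by move=> x; rewrite -[x]reprK !piE mulVg. Qed.
Lemma quotient_mulrV : right_inverse quotient_one quotient_inv quotient_mul.
Proof. by move=> x; rewrite -[x]reprK !piE mulgV. Qed.

HB.instance Definition _ := isGroup.Build quotient
  quotient_mulA quotient_mul1 quotient_mulr1 quotient_mulV quotient_mulrV.

End Quotient.

(* Nested finite index normal subgroups with trivial intersection; the
   sequence is indexed from 0. *)
Definition box_sequence (G : groupType) (K : nat -> normalSubgroup G) : Prop :=
  [/\ forall i, {subset K i.+1 <= K i},
      forall i, finite_set [set: quotient (K i)]
    & forall x : G, (forall i, x \in K i) -> x = 1%g].

Section BoxSpace.
Variables (R : realType) (G : groupType) (S : seq G).
Variable K : nat -> normalSubgroup G.

Definition box_space : Type := {i : nat & quotient (K i)}.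

Definition level_dist (i : nat) : quotient (K i) -> quotient (K i) -> R :=
  word_dist R (map \pi_(quotient (K i)) S).

Definition level_diam (i : nat) : R :=
  sup [set level_dist z.1 z.2 | z in [set: quotient (K i) * quotient (K i)]].

(* D i is the distance between the identity elements of G/K_i and G/K_(i+1). *)
Definition admissible_gaps (D : nat -> R) : Prop :=
  forall i, Num.max (level_diam i) (level_diam i.+1) < D i.

Variable D : nat -> R.

(* The distance between points a and b of levels tag a < tag b. *)
Definition cross_dist (a b : box_space) : R :=
  level_dist (tagged a) 1%g + \sum_(tag a <= k < tag b) D k
  + level_dist 1%g (tagged b).

Definition box_dist (a b : box_space) : R :=
  if (tag a < tag b)%N then cross_dist a b
  else if (tag b < tag a)%N then cross_dist b a
  else level_dist (tagged a) (tagged_as a b).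

End BoxSpace.

Section CoarseEmbedding.
Variables (R : realType) (X Y : Type) (dX : X -> X -> R) (dY : Y -> Y -> R).

(* A control function from R_+ to R_+; its values at negative reals are
   irrelevant. *)
Definition control_function (rho : R -> R) : Prop :=
  [/\ forall t, 0 <= t -> 0 <= rho t,
      forall s t, 0 <= s -> s <= t -> rho s <= rho t
    & rho t @[t --> +oo] --> +oo].

Definition coarsely_embeds : Prop :=
  exists (f : X -> Y) (rho_minus rho_plus : R -> R),
    [/\ control_function rho_minus, control_function rho_plus
      & forall x x', rho_minus (dX x x') <= dY (f x) (f x')
                                         <= rho_plus (dX x x')].

End CoarseEmbedding.

(* The separable Hilbert space l^2(N) over R. *)
Definition ell2 (R : realType) : Type :=
  {x : nat -> R | cvgn (series (fun n => x n ^+ 2))}.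

Definition ell2_dist (R : realType) (x y : ell2 R) : R :=
  Num.sqrt (limn (series (fun n => (sval x n - sval y n) ^+ 2))).

(* Main.v *)
Require Import Defs.
From HB Require Import structures.
From mathcomp Require Import all_boot all_order all_algebra.
From mathcomp Require Import perm.
From mathcomp Require Import all_classical all_reals.
From mathcomp Require Import topology normedtype sequences.
From mathcomp Require Import ring lra.

Set Implicit Arguments.
Unset Strict Implicit.
Unset Printing Implicit Defensive.

Import Order.TTheory GRing.Theory Num.Theory.
Import numFieldNormedType.Exports.
Local Open Scope classical_set_scope.
Local Open Scope quotient_scope.

(** Let M_0 = F and let M_(n+1) be the subgroup of M_n generated by squares
    ([mod2_series]). These subgroups are invariant under all endomorphisms of F,
    and the Cayley graph of F/M_(n+1) is the mod 2 homology cover of the one of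
    F/M_n. A path in F/M_n has a mod 2 chain, the set of edges that it crosses an
    odd number of times; the chain of a path from the base point only depends on
    the class of its label modulo M_(n+1). So each edge of the Cayley graph of
    F/M_n is a wall of F/M_(n+1), and the number of walls between two points is
    at most their distance. Conversely a chain with few edges is the chain of a
    short path: a leftover cycle would be shorter than the girth of F/M_n
    ([exists_walls]). The girth grows with n because a shortest cycle crosses its
    first edge once ([injective_ballS]); this also gives that the M_n intersect
    trivially.

    In the extension G, with t above a generator of C, some power t^k acts
    trivially on the finite group F/M_(n+1), and t^k together with M_(n+1)
    generates a normal subgroup K_n of finite index that meets F in M_(n+1)
    ([exists_box_subgroups]).

    The subgroup F/M_(n+1) of G/K_n may be distorted, so the walls alone do not give
    an embedding of G/K_n. For a parameter kappa in [0, 1], kappa to the power of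
    the number of walls is the inner product of unit vectors, which gives unit
    vectors on each coset of F; distinct cosets are made orthogonal. Averaging
    them over right translates by a finite set T, almost invariant modulo F, gives
    unit vectors at the points of G/K_n that nearly agree at neighbours and have
    inner products at most 1/2 at points far apart, uniformly in n. Such T exist
    since C is amenable ([exists_folner]), and kappa is taken close to 1 depending
    on T ([exists_scale_kernel]). Summing the squared distances over a sequence of
    scales gives embeddings of the levels with common control functions
    ([exists_level_kernels]).

    The levels are put together with one more coordinate, the sum of the gaps
    below a level. It dominates the distance between points of distinct levels,
    as each gap exceeds the two adjacent diameters ([box_coarsely_embeds]). *)

(** * Free groups on a finite basis *)

Section MultiplicativeMaps.
Variables (G H : groupType) (h : {multiplicative G -> H}).
Local Open Scope group_scope.

Lemma mult1 : h 1 = 1.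
Proof. by apply: (@mulgI _ (h 1)); rewrite -gmulfM !mulg1. Qed.

Lemma multV x : h x^-1 = (h x)^-1.
Proof. by apply: (@mulgI _ (h x)); rewrite -gmulfM !mulgV mult1. Qed.

Lemma multX x n : h (x ^+ n) = h x ^+ n.
Proof. by elim: n => [|n IH]; rewrite ?mult1 // !expgS gmulfM IH. Qed.

Lemma multJ x y : h (x ^ y) = h x ^ h y.
Proof. by rewrite !conjgE !gmulfM multV. Qed.

End MultiplicativeMaps.

Section Words.
Context {G : groupType} {I : Type} (b : I -> G).
Local Open Scope group_scope.

Definition letter (l : I * bool) : G := if l.2 then b l.1 else (b l.1)^-1.

Definition wprod (w : seq (I * bool)) : G := \prod_(l <- w) letter l.

Definition inv_word (w : seq (I * bool)) := rev [seq (l.1, ~~ l.2) | l <- w].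

Lemma wprod_nil : wprod [::] = 1.
Proof. by rewrite /wprod big_nil. Qed.

Lemma wprod_cons l w : wprod (l :: w) = letter l * wprod w.
Proof. by rewrite /wprod big_cons. Qed.

Lemma wprod_cat v w : wprod (v ++ w) = wprod v * wprod w.
Proof. by rewrite /wprod big_cat. Qed.

Lemma letterN l : letter (l.1, ~~ l.2) = (letter l)^-1.
Proof. by case: l => j [] //=; rewrite /letter /= invgK. Qed.

Lemma wprod_inv w : wprod (inv_word w) = (wprod w)^-1.
Proof.
elim: w => [|l w IH]; first by rewrite wprod_nil invg1.
rewrite /inv_word /= rev_cons -cats1 wprod_cat -/(inv_word w) IH wprod_cons.
by rewrite wprod_nil mulg1 letterN wprod_cons invgM.
Qed.

End Words.

Definition free_basis (F : groupType) (I : finType) (b : I -> F) : Prop :=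
  (forall (H : groupType) (g : I -> H),
     exists h : {multiplicative F -> H}, forall j, h (b j) = g j) /\
  forall x, exists w, x = wprod b w.

Section FiniteBasis.
Variable F : groupType.
Local Open Scope group_scope.

Section Span.
Variable X : set F.

Definition in_span (x : F) : bool :=
  `[< exists2 w, {in w, forall l, X l.1} & x = wprod id w >].

Lemma in_span1 : 1 \in in_span.
Proof. by apply/asboolP; exists [::]; rewrite // wprod_nil. Qed.

Lemma in_spanF : {in in_span &, forall x y, x / y \in in_span}.
Proof.
move=> x y /asboolP[v Xv ->] /asboolP[w Xw ->]; apply/asboolP.
exists (v ++ inv_word w); last by rewrite wprod_cat wprod_inv.
move=> l; rewrite mem_cat mem_rev => /orP[/Xv//|/mapP[l' /Xw Xl' ->]//].
Qed.

HB.instance Definition _ :=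
  isMul1Closed.Build F in_span in_span1.

Record span := Span { span_val : F; span_valP : span_val \in in_span }.
HB.instance Definition _ := [isSub for span_val].
HB.instance Definition _ := [Choice of span by <:].
HB.instance Definition _ :=
  SubChoice_isSubGroup.Build F in_span span (conj in_span1 in_spanF).

End Span.

(** The morphism from F to the subgroup spanned by X that extends the inclusion
    of X is, seen as an endomorphism of F, the identity on X, so the identity. *)
Lemma free_on_span X : free_on X -> forall x : F, x \in in_span X.
Proof.
move=> freeX x.
have Xspan y : X y -> y \in in_span X.
  move=> Xy; apply/asboolP; exists [:: (y, true)]; last first.
    by rewrite wprod_cons wprod_nil mulg1.
  by move=> l; rewrite inE => /eqP ->.
have [h [hX _]] := freeX (span X) (insubd (1 : span X)).
have [h' [_ uniq]] := freeX F id.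
have := uniq (val \o h : {multiplicative F -> F}).
have := uniq (idfun : {multiplicative F -> F}).
move=> E1 E2.
have -> : x = val (h x).
  have /= -> := E2 _ x; first exact: E1.
  by move=> y Xy /=; rewrite hX // insubdK // Xspan.
exact: valP.
Qed.

(** Finitely many generators are words in finitely many elements of X; an
    element x of X outside that list would be sent to 1 by the morphism to Z/2
    that detects x. *)
Lemma free_fg_basis : free_group F -> finitely_generated F ->
  exists (I : finType) (b : I -> F), free_basis b.
Proof.
move=> [X freeX] [S genS].
have spanX := free_on_span freeX.
have [xs Xxs genxs] : exists2 xs : seq F, {in xs, forall x, X x} &
    {in S, forall s, s \in in_span [set` xs]}.
  elim: S {genS} => [|s S [xs Xxs genxs]]; first by exists [::].
  have /asboolP[w Xw sw] := spanX s.
  exists ([seq l.1 | l <- w] ++ xs).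
    by move=> x; rewrite mem_cat => /orP[/mapP[l /Xw Xl ->]//|/Xxs].
  move=> u; rewrite inE => /orP[/eqP ->|/genxs/asboolP[v Xv uv]]; apply/asboolP.
    by exists w => // l lw; rewrite /= mem_cat map_f.
  by exists v => // l /Xv /= lxs; rewrite mem_cat lxs orbT.
have {genS genxs} genxs x : x \in in_span [set` xs].
  have [w Sw ->] := genS x; elim: w Sw => [|s w IH] Sw.
    by rewrite big_nil in_span1.
  rewrite big_cons -[X in _ * X]invgK; apply: in_spanF; last first.
    rewrite -[_^-1]mul1g; apply: in_spanF; first exact: in_span1.
    by apply: IH => u uw; apply: Sw; rewrite inE uw orbT.
  case: (Sw s (mem_head _ _)) => [|/genxs Ss]; first exact: genxs.
  by rewrite -[s]invgK -[X in X \in _]mul1g; apply: in_spanF; rewrite ?in_span1.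
have Xsub x : X x -> x \in xs.
  move=> Xx; apply: contrapT => /negP xxs.
  pose g y : {perm bool} := if y == x then tperm true false else 1.
  have [h [hX _]] := freeX _ g.
  have hxs y : y \in xs -> h y = 1.
    move=> yxs; rewrite hX /g; last exact: Xxs.
    by case: eqP yxs xxs => // -> ->.
  have := hX _ Xx; have /asboolP[w Xw {1}->] := genxs x.
  suff -> : h (wprod id w) = 1.
    by rewrite /g eqxx => /permP/(_ true); rewrite tpermL perm1.
  elim: w Xw => [|l w IH] Xw; first by rewrite wprod_nil mult1.
  rewrite wprod_cons gmulfM IH => [|m mw]; last by apply: Xw; rewrite inE mw orbT.
  rewrite mulg1 /letter.
  by case: l.2 (Xw l (mem_head _ _)) => /hxs; rewrite ?multV => ->; rewrite ?invg1.
exists (seq_sub xs), val; split=> [H g|x].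
  pose g' x := if insub x is Some j then g j else 1.
  have [h [hX _]] := freeX H g'.
  by exists h => j; rewrite hX /g' ?valK //; apply: Xxs; exact: ssvalP.
have /asboolP[w Xw ->] := genxs x; elim: w Xw {x} => [|[y e] w IH] Xw.
  by exists [::]; rewrite !wprod_nil.
have [v vw] : exists v, wprod id w = wprod (val : seq_sub xs -> F) v.
  by apply: IH => l lw; apply: Xw; rewrite inE lw orbT.
have yxs : y \in xs by exact: (Xw _ (mem_head _ _)).
by exists ((SeqSub yxs, e) :: v); rewrite !wprod_cons vw.
Qed.

End FiniteBasis.

(** * Normal subgroups and coset spaces *)

Record normal_set (G : groupType) (N : set G) : Prop := NormalSet {
  normal_set1 : N 1%g;
  normal_setM : forall x y, N x -> N y -> N (x * y)%g;
  normal_setV : forall x, N x -> N (x^-1)%g;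
  normal_setJ : forall x y, N x -> N (x ^ y)%g
}.

(** Only an upper bound on the number of cosets is asked for, so that a map to a
    finite type that separates the cosets is enough. *)
Definition finite_index (G : groupType) (N : set G) : Prop :=
  exists (T : finType) (q : G -> T), forall x y, q x = q y -> N (x^-1 * y)%g.

Definition coset_space (G : groupType) (N : set G) (T : Type)
    (q : G -> T) (r : T -> G) : Prop :=
  (forall x y, q x = q y <-> N (x^-1 * y)%g) /\ cancel r q.

Section Cosets.
Context {G : groupType}.
Implicit Types N : set G.
Local Open Scope group_scope.

Lemma normal_setVE N x : normal_set N -> N x^-1 -> N x.
Proof. by move=> nN /(normal_setV nN); rewrite invgK. Qed.

Lemma normal_setJE N x y : normal_set N -> N (x ^ y) -> N x.
Proof. by move=> nN /(normal_setJ nN y^-1); rewrite conjgK. Qed.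

Lemma coset_sym N x y : normal_set N -> N (x^-1 * y) -> N (y^-1 * x).
Proof. by move=> nN /(normal_setV nN); rewrite invgM invgK. Qed.

Lemma coset_trans N x y z : normal_set N ->
  N (x^-1 * y) -> N (y^-1 * z) -> N (x^-1 * z).
Proof. by move=> nN xy /(normal_setM nN xy); rewrite mulgA mulgK. Qed.

Lemma coset_eq N x y : normal_set N -> N (x^-1 * y) ->
  [set z | N (x^-1 * z)] = [set z | N (y^-1 * z)].
Proof.
move=> nN xy; apply/seteqP; split=> z /=; last exact: (coset_trans nN xy).
exact/(coset_trans nN)/(coset_sym nN xy).
Qed.

Definition coset_rep N (x : G) : G := xget 1 [set z | N (x^-1 * z)].

Lemma coset_repP N x : normal_set N -> N (x^-1 * coset_rep N x).
Proof.
move=> nN; apply: (@xgetPex _ 1 [set z | N (x^-1 * z)]); exists x => /=.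
by rewrite mulVg; exact: normal_set1.
Qed.

Lemma coset_rep_eq N x y : normal_set N -> N (x^-1 * y) ->
  coset_rep N x = coset_rep N y.
Proof. by move=> nN xy; rewrite /coset_rep (coset_eq nN xy). Qed.

Lemma exists_coset_space N : normal_set N -> finite_index N ->
  exists (T : finType) (q : G -> T) (r : T -> G), coset_space N q r.
Proof.
move=> nN [U [q qP]].
pose q' x := q (coset_rep N x).
have q'P x y : q' x = q' y <-> N (x^-1 * y).
  split=> [/qP xy|xy]; last by rewrite /q' (coset_rep_eq nN xy).
  apply: (coset_trans nN (coset_repP x nN)); apply: (coset_trans nN xy).
  by apply: coset_sym => //; exact: coset_repP.
pose T := {u : U | `[< exists x, q' x = u >]}.
have imP x : `[< exists y, q' y = q' x >] by apply/asboolP; exists x.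
have [r rP] : {r : T -> G & forall t, q' (r t) = val t}.
  by apply: (@choice T G (fun t x => q' x = val t)) => -[u uP] /=; exact/asboolP.
exists T, (fun x => exist _ (q' x) (imP x)), r; split=> [x y|t].
  rewrite -q'P; split=> [/(congr1 val)//|xy]; exact/val_inj.
by apply: val_inj; rewrite /= rP.
Qed.

End Cosets.

(** * The mod 2 homology cover of a finite Cayley graph *)

Section Mod2Kernel.
Context {F : groupType}.
Implicit Types N : set F.
Local Open Scope group_scope.

Definition additive_mod2 N (phi : F -> bool) :=
  forall x y, N x -> N y -> phi (x * y) = phi x (+) phi y.

(** This is the subgroup of N generated by squares. As the intersection of the
    kernels of all morphisms from N to Z/2 it is at once invariant under
    endomorphisms and contained in the kernel of each coordinate of the chain. *)
Definition mod2_kernel N : set F :=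
  [set x | N x /\ forall phi, additive_mod2 N phi -> phi x = false].

Lemma additive_mod2_1 N phi : N 1 -> additive_mod2 N phi -> phi 1 = false.
Proof. by move=> N1 /(_ 1 1 N1 N1); rewrite mulg1; case: (phi 1). Qed.

Lemma additive_mod2V N phi x : normal_set N -> additive_mod2 N phi -> N x ->
  phi x^-1 = phi x.
Proof.
move=> nN add Nx; have := add _ _ Nx (normal_setV nN Nx).
rewrite mulgV (additive_mod2_1 _ add); last exact: normal_set1.
by case: (phi x); case: (phi _).
Qed.

Lemma mod2_kernel_endo N (a : F -> F) : {morph a : x y / x * y} ->
  (forall x, N x -> N (a x)) ->
  forall x, mod2_kernel N x -> mod2_kernel N (a x).
Proof.
move=> aM aN x [Nx xP]; split=> [|phi add]; first exact: aN.
apply: (xP (phi \o a)) => y z Ny Nz /=.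
by rewrite aM add //; exact: aN.
Qed.

Lemma mod2_kernel_normal N : normal_set N -> normal_set (mod2_kernel N).
Proof.
move=> nN; split=> [|x y [Nx xP] [Ny yP]|x [Nx xP]|x y].
- split=> [|phi]; first exact: normal_set1.
  by apply: additive_mod2_1; exact: normal_set1.
- by split=> [|phi add]; [exact: normal_setM|rewrite add // xP // yP].
- split=> [|phi add]; first exact: normal_setV.
  by rewrite (additive_mod2V nN add Nx) xP.
- apply: (@mod2_kernel_endo N (fun x => x ^ y)) => [u v|u Nu].
    exact: conjMg.
  exact: normal_setJ.
Qed.

End Mod2Kernel.

Definition weight (E : finType) (z : {ffun E -> bool}) : nat := #|[pred e | z e]|.

Section Chains.
Variables (F : groupType) (I : finType) (b : I -> F).
Hypothesis basis : free_basis b.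
Variables (N : set F) (T : finType) (q : F -> T) (r : T -> F).
Hypotheses (nN : normal_set N) (qrN : coset_space N q r).
Local Open Scope group_scope.

(* The vertices of the Cayley graph of F/N are the elements of T; the pair
   (t, j) is its edge from t to t * b_j. *)
Local Notation edge := (T * I)%type.
Local Notation chain_type := {ffun edge -> bool}.

Definition act (t : T) (x : F) : T := q (r t * x).

Lemma act_q x y : act (q x) y = q (x * y).
Proof.
apply/qrN.1; rewrite invgM -mulgA; set z := _ * (x * y).
have -> : z = ((r (q x))^-1 * x) * y by rewrite /z mulgA.
rewrite -conjgE; apply: normal_setJ => //; apply/qrN.1; exact: qrN.2.
Qed.

Lemma act1 t : act t 1 = t.
Proof. by rewrite /act mulg1 qrN.2. Qed.

Lemma actM t x y : act t (x * y) = act (act t x) y.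
Proof. by rewrite [act t x]/act act_q /act mulgA. Qed.

Lemma actK t x : act (act t x) x^-1 = t.
Proof. by rewrite -actM mulgV act1. Qed.

Lemma actKV t x : act (act t x^-1) x = t.
Proof. by rewrite -actM mulVg act1. Qed.

Lemma act_fix t x : act t x = t <-> N x.
Proof.
rewrite /act -{2}[t]qrN.2 qrN.1 invgM mulgVK; split.
  exact: normal_setVE.
exact: normal_setV.
Qed.

Lemma act_eq t x y : act t x = act t y -> N (x^-1 * y).
Proof. by rewrite /act qrN.1 invgM -mulgA mulKg. Qed.

Definition delta (e : edge) : chain_type := [ffun e' => e' == e].

Definition cross_fwd j (u : T * chain_type) : T * chain_type :=
  (act u.1 (b j), (u.2 + delta (u.1, j))%R).

Definition cross_bwd j (u : T * chain_type) : T * chain_type :=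
  (act u.1 (b j)^-1, (u.2 + delta (act u.1 (b j)^-1, j))%R).

Lemma add_chainK (z z' : chain_type) : (z + z' + z')%R = z.
Proof. by apply/ffunP => e; rewrite !ffunE; case: (z e); case: (z' e). Qed.

Lemma cross_fwdK j : cancel (cross_fwd j) (cross_bwd j).
Proof. by case=> t z; rewrite /cross_bwd /= actK add_chainK. Qed.

Lemma cross_bwdK j : cancel (cross_bwd j) (cross_fwd j).
Proof. by case=> t z; rewrite /cross_fwd /= actKV add_chainK. Qed.

(** The universal property of the basis makes a word act on pairs of a vertex and
    a chain: it moves the vertex along its path and toggles the edges that it
    crosses. *)
Definition walk : {multiplicative F -> {perm T * chain_type}} :=
  projT1 (cid (basis.1 _ (fun j => perm (can_inj (cross_fwdK j))))).

Definition edge_of (t : T) (l : I * bool) : edge :=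
  if l.2 then (t, l.1) else (act t (letter b l), l.1).

Lemma walk_letter l t z : walk (letter b l) (t, z) =
  (act t (letter b l), (z + delta (edge_of t l))%R).
Proof.
have E j : walk (b j) = perm (can_inj (cross_fwdK j)) :=
  projT2 (cid (basis.1 _ (fun j => perm (can_inj (cross_fwdK j))))) j.
case: l => j []; rewrite /letter /edge_of; first by rewrite E permE.
apply: (@perm_inj _ (perm (can_inj (cross_fwdK j)))).
by rewrite multV E permKV permE -/(cross_bwd j (t, z)) cross_bwdK.
Qed.

(** The mod 2 sum of the edges crossed by the path that starts at t and is
    labelled by a word for x. *)
Definition chain (t : T) (x : F) : chain_type := (walk x (t, 0%R)).2.

Lemma walkE x t z : walk x (t, z) = (act t x, (z + chain t x)%R).
Proof.
have [w ->] := basis.2 x; rewrite /chain; elim: w t z => [|l w IH] t z.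
  by rewrite wprod_nil mult1 !perm1 addr0 act1.
rewrite wprod_cons gmulfM !permM actM !walk_letter.
by rewrite IH [in RHS]IH add0r addrA.
Qed.

Lemma chain1 t : chain t 1 = 0%R.
Proof. by rewrite /chain mult1 perm1. Qed.

Lemma chainM t x y : chain t (x * y) = (chain t x + chain (act t x) y)%R.
Proof. by rewrite /chain gmulfM permM walkE add0r walkE. Qed.

Lemma chain_letter t l : chain t (letter b l) = delta (edge_of t l).
Proof. by rewrite /chain walk_letter add0r. Qed.

Lemma chain_cons t l w : chain t (wprod b (l :: w)) =
  (delta (edge_of t l) + chain (act t (letter b l)) (wprod b w))%R.
Proof. by rewrite wprod_cons chainM chain_letter. Qed.

Lemma chain_mod2_kernel t x : mod2_kernel N x -> chain t x = 0%R.
Proof.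
move=> [Nx xP]; apply/ffunP => e; rewrite ffunE.
apply: (xP (fun y => chain t y e)) => y z Ny Nz.
by rewrite chainM ffunE; have /act_fix -> := Ny.
Qed.

Definition schreier (t : T) (x : F) : F := r t * x * (r (act t x))^-1.

Lemma schreierN t x : N (schreier t x).
Proof.
apply/(act_fix (q 1)); rewrite /schreier actM act_q mul1g -/(act t x).
by rewrite -{1}[act t x]qrN.2 act_q mulgV.
Qed.

Lemma schreierM t x y :
  schreier t (x * y) = schreier t x * schreier (act t x) y.
Proof. by rewrite /schreier actM !mulgA mulgVK. Qed.

Lemma schreierV t x : schreier (act t x) x^-1 = (schreier t x)^-1.
Proof. by rewrite /schreier actK !invgM invgK mulgA. Qed.

(** A path decomposes its label into Schreier generators, one for each edge
    crossed; a morphism to Z/2 forgets their order and their signs, so it only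
    sees the chain of the path. *)
Lemma schreier_mod2 (phi : F -> bool) t w : additive_mod2 N phi ->
  phi (schreier t (wprod b w)) =
  (\sum_e (chain t (wprod b w) e && phi (schreier e.1 (b e.2))))%R.
Proof.
move=> add; elim: w t => [|l w IH] t.
  rewrite wprod_nil /schreier act1 mulg1 mulgV (additive_mod2_1 _ add).
    by rewrite big1 // => e _; rewrite chain1 ffunE.
  exact: normal_set1.
rewrite wprod_cons schreierM add ?IH; try exact: schreierN.
rewrite chainM chain_letter.
under [RHS]eq_bigr => e _ do rewrite ffunE andb_addl.
rewrite big_split /=; congr (_ (+) _).
rewrite (bigD1 (edge_of t l)) //= !ffunE eqxx /= big1; last first.
  by move=> e /negbTE; rewrite ffunE => ->.
rewrite addr0; case: l => j [] //=; rewrite /edge_of /letter /=.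
by rewrite -(additive_mod2V nN add (schreierN _ _)) -schreierV invgK.
Qed.

Lemma chain_eq0_mod2 t x : N x -> chain t x = 0%R -> mod2_kernel N x.
Proof.
move=> Nx x0; apply: (@normal_setJE _ _ _ (r t)^-1 (mod2_kernel_normal nN)).
split=> [|phi add]; first exact: normal_setJ.
have [w xw] := basis.2 x; have := schreier_mod2 t w add.
rewrite -xw x0 /schreier; have /act_fix -> := Nx.
rewrite conjgE invgK mulgA => ->.
by rewrite big1 // => e _; rewrite ffunE.
Qed.

Lemma mod2_kernel_finite_index : finite_index (mod2_kernel N).
Proof.
exists (T * chain_type)%type, (fun x => (q x, chain (q 1) x)) => x y [xy Cxy].
have Nxy := (qrN.1 _ _).1 xy.
apply: (@chain_eq0_mod2 (act (q 1) x)) => //.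
move: Cxy; rewrite -{1}(mulVKg x y) chainM => /esym/eqP.
by rewrite -subr_eq0 addrAC subrr add0r => /eqP.
Qed.

Definition endpoints (e : edge) (v : T) : bool :=
  (v == e.1) (+) (v == act e.1 (b e.2)).

Definition boundary (z : chain_type) (v : T) : bool :=
  (\sum_e (z e && endpoints e v))%R.

Lemma boundaryD z z' v : boundary (z + z')%R v = boundary z v (+) boundary z' v.
Proof.
rewrite /boundary; under eq_bigr => e _ do rewrite ffunE andb_addl.
by rewrite big_split.
Qed.

Lemma boundary_delta e v : boundary (delta e) v = endpoints e v.
Proof.
rewrite /boundary (bigD1 e) //= ffunE eqxx /= big1 ?addr0 //.
by move=> e' /negbTE; rewrite ffunE => ->.
Qed.

Lemma endpoints_edge_of t l v :
  endpoints (edge_of t l) v = (v == t) (+) (v == act t (letter b l)).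
Proof.
case: l => j [] //=; rewrite /endpoints /edge_of /letter /= actKV.
by rewrite addbC.
Qed.

Lemma boundary_chain t x v : boundary (chain t x) v = (v == t) (+) (v == act t x).
Proof.
have [w ->] := basis.2 x; elim: w t => [|l w IH] t.
  rewrite wprod_nil chain1 act1 addbb /boundary big1 // => e _.
  by rewrite ffunE.
rewrite chain_cons boundaryD IH boundary_delta endpoints_edge_of wprod_cons actM.
by rewrite addbA addbK.
Qed.

Lemma weightD (z z' : chain_type) : (weight (z + z')%R <= weight z + weight z')%N.
Proof.
rewrite /weight -cardUI; apply: leq_trans (leq_addr _ _); apply: subset_leq_card.
by apply/fintype.subsetP => e; rewrite !inE ffunE; case: (z e); case: (z' e).
Qed.

Lemma weight_delta e : weight (delta e) = 1%N.
Proof. by rewrite /weight -(card1 e); apply: eq_card => e'; rewrite !inE ffunE. Qed.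

Lemma weight_chain t w : (weight (chain t (wprod b w)) <= size w)%N.
Proof.
elim: w t => [|l w IH] t.
  by rewrite wprod_nil chain1 leqn0; apply/eqP/eq_card0 => e; rewrite !inE ffunE.
rewrite chain_cons; apply: leq_trans (weightD _ _) _.
by rewrite weight_delta add1n ltnS.
Qed.

Lemma delta_boundary_letter e v : endpoints e v ->
  exists2 l, e = edge_of v l &
    forall v', endpoints e v' = (v' == v) (+) (v' == act v (letter b l)).
Proof.
case: e => t j; rewrite /endpoints /=.
have [-> _|vt /= /eqP vtj] := eqVneq v t.
  by exists (j, true).
exists (j, false); first by rewrite /edge_of /letter /= vtj actK.
by move=> v'; rewrite /letter /= vtj actK addbC.
Qed.

(** Unless s = t, a chain with boundary s + t has an edge at s, as s is an
    endpoint of an odd number of its edges; crossing that edge leaves a chain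
    with one edge fewer. *)
Lemma exists_trail n z s t : (weight z <= n)%N ->
  (forall v, boundary z v = (v == s) (+) (v == t)) ->
  exists w, [/\ act s (wprod b w) = t, (size w <= n)%N &
    forall e, chain s (wprod b w) e -> z e].
Proof.
elim: n z s => [|n IH] z s zn dz.
  have z0 e : z e = false.
    have := card0_eq (eqP (etrans (esym (leqn0 _)) zn)) e.
    by rewrite !inE.
  exists [::]; rewrite wprod_nil act1 chain1; split=> // [|e]; last by rewrite ffunE.
  have := dz s; rewrite eqxx /boundary big1 => [|e _]; last by rewrite z0.
  by case: eqP.
have [st|st] := eqVneq s t.
  by exists [::]; rewrite wprod_nil act1 chain1; split=> // e; rewrite ffunE.
have [e ze es] : exists2 e, z e & endpoints e s.
  apply: contrapT => noe; have := dz s; rewrite eqxx (negbTE st) /boundary.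
  rewrite big1 // => e _; apply/negbTE/negP => /andP[ze es].
  by apply: noe; exists e.
have [l el ends] := delta_boundary_letter es.
have [||w [wt wn wz]] := IH (z + delta e)%R (act s (letter b l)).
- rewrite -ltnS; apply: leq_trans zn; apply: proper_card; apply/fintype.properP; split.
    apply/fintype.subsetP => e'; rewrite !inE !ffunE.
    by have [->|] := eqVneq e' e; [rewrite ze|rewrite addr0].
  by exists e; rewrite !inE // !ffunE eqxx ze.
- move=> v; rewrite boundaryD boundary_delta dz ends.
  by case: (v == s); case: (v == t); case: (v == _).
exists (l :: w); rewrite wprod_cons actM; split=> // e'.
rewrite chainM chain_letter -el !ffunE.
have [-> //|ne] := eqVneq e' e.
by rewrite add0r => /wz; rewrite !ffunE (negbTE ne) addr0.
Qed.

(** A trail in z minus an edge e, from one end of e to the other, closes up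
    through e. It crosses e exactly once, so its chain is not zero and its label
    is not 1. *)
Lemma exists_closed_trail z : (forall v, boundary z v = false) -> z != 0%R ->
  exists w, [/\ N (wprod b w), wprod b w != 1 & (size w <= weight z)%N].
Proof.
move=> dz z0; have [e ze] : exists e, z e.
  apply: contrapT => noe; case/negP: z0; apply/eqP/ffunP => e; rewrite ffunE.
  by apply/negbTE/negP => ze; apply: noe; exists e.
pose l := (e.2, true).
have el : edge_of e.1 l = e by rewrite /edge_of /= -surjective_pairing.
have [n zn] : exists n, weight z = n.+1.
  by exists (weight z).-1; rewrite prednK //; apply/card_gt0P; exists e.
have [||w [wt wn wz]] := @exists_trail n (z + delta e)%R (act e.1 (letter b l)) e.1.
- rewrite -ltnS -zn; apply: proper_card; apply/fintype.properP; split.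
    apply/fintype.subsetP => e'; rewrite !inE !ffunE.
    by have [->|] := eqVneq e' e; [rewrite ze|rewrite addr0].
  by exists e; rewrite !inE // !ffunE eqxx ze.
- move=> v; rewrite boundaryD boundary_delta dz -el endpoints_edge_of el.
  by rewrite addFb addbC.
exists (l :: w); split; last by rewrite zn.
  by apply/(act_fix e.1); rewrite wprod_cons actM.
apply/eqP => lw1; have := chain1 e.1; rewrite -lw1 wprod_cons chainM chain_letter el.
move=> /ffunP/(_ e); rewrite !ffunE eqxx.
by case E: (chain _ _ e) => // _; have := wz _ E; rewrite !ffunE eqxx ze.
Qed.

Definition injective_ball (n : nat) : Prop :=
  forall w, (size w <= n)%N -> N (wprod b w) -> wprod b w = 1.

(** A trail u inside the chain of x, with the same ends, differs from it by a
    cycle with at most n edges. Below the girth this cycle is zero, so u and x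
    have the same chain and agree modulo the mod 2 kernel. *)
Lemma short_of_weight_chain n t x : injective_ball n ->
  (weight (chain t x) <= n)%N ->
  exists2 u, (size u <= n)%N & mod2_kernel N ((wprod b u)^-1 * x).
Proof.
move=> inj cn.
have [u [ut un uz]] := exists_trail cn (boundary_chain t x).
exists u => //.
have dz v : boundary (chain t x + chain t (wprod b u))%R v = false.
  by rewrite boundaryD !boundary_chain ut addbb.
have cu : (chain t x + chain t (wprod b u))%R = 0%R.
  apply/eqP/negPn/negP => /(exists_closed_trail dz)[w [Nw w1 wn]].
  move/eqP: w1; apply; apply: inj => //; apply: leq_trans wn _.
  apply: leq_trans cn; apply: subset_leq_card; apply/fintype.subsetP => e.
  rewrite !inE ffunE; case E: (chain t x e) => //.
  by rewrite add0r => /uz; rewrite E.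
apply: (@chain_eq0_mod2 (act t (wprod b u))); first exact: act_eq ut.
have := cu; rewrite -{1}(mulVKg (wprod b u) x) chainM => {}cu.
by apply/ffunP => e; move/ffunP/(_ e): cu; rewrite !ffunE; do 2!case: (chain _ _ e).
Qed.

Lemma chain_split t w e : chain t (wprod b w) e ->
  exists v l v', w = v ++ l :: v' /\ edge_of (act t (wprod b v)) l = e.
Proof.
elim: w t => [|l w IH] t; first by rewrite wprod_nil chain1 ffunE.
rewrite chain_cons !ffunE; have [-> _|_] := eqVneq e (edge_of t l).
  by exists [::], l, w; rewrite wprod_nil act1.
rewrite add0r => /IH[v [l' [v' [-> <-]]]].
by exists (l :: v), l', v'; rewrite wprod_cons actM.
Qed.

(** A shortest nontrivial word in N labels a cycle that crosses its first edge
    once, as a second crossing would cut out a shorter word in N; hence it does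
    not survive in the mod 2 kernel. *)
Lemma injective_ballS n : injective_ball n ->
  forall w, (size w <= n.+1)%N -> mod2_kernel N (wprod b w) -> wprod b w = 1.
Proof.
move=> inj [|l w]; first by rewrite wprod_nil.
rewrite /= ltnS => wn Kw; have Nw := Kw.1.
have := chain_mod2_kernel (q 1) Kw; rewrite chain_cons.
move=> /ffunP/(_ (edge_of (q 1) l)); rewrite !ffunE eqxx.
case E: (chain _ _ _) => // _.
have [v [l' [v' [wE]]]] := chain_split E.
have vn : (size v + size v' < n)%N by move: wn; rewrite wE size_cat /= addnS.
have vn1 : (size v < n)%N by apply: leq_ltn_trans vn; exact: leq_addr.
have vn2 : (size v' < n)%N by apply: leq_ltn_trans vn; exact: leq_addl.
set t1 := act _ (letter b l); set s := act t1 _ => El.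
have wE' : wprod b (l :: w) = letter b l * wprod b v * (letter b l' * wprod b v').
  by rewrite wE wprod_cons wprod_cat wprod_cons !mulgA.
(* If both crossings have the same direction, l :: v is a shorter cycle. *)
have same : l = l' -> s = q 1 -> wprod b (l :: w) = 1.
  move=> ll sq; have lv1 : wprod b (l :: v) = 1.
    by apply: inj => //; apply/(act_fix (q 1)); rewrite wprod_cons actM.
  rewrite -wprod_cons lv1 mul1g -wprod_cons in wE'; rewrite wE'.
  by apply: inj => //; rewrite -wE'.
(* If they have opposite directions, v is a shorter cycle. *)
have opposite : letter b l' = (letter b l)^-1 -> s = t1 -> wprod b (l :: w) = 1.
  move=> ll st; have v1 : wprod b v = 1.
    by apply: inj (ltnW vn1) _; apply/(act_fix t1).
  rewrite v1 mulg1 ll mulVKg in wE'; rewrite wE'.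
  by apply: inj (ltnW vn2) _; rewrite -wE'.
clearbody s; move: El same opposite; rewrite /t1.
case: (l) (l') => [j []] [j' []]; rewrite /edge_of /letter /= => -[];
  move=> + jj; rewrite {}jj => E1 same opposite.
- exact: same.
- by apply: opposite => //; rewrite -E1 actKV.
- by apply: opposite; rewrite ?invgK.
- by apply: same => //; rewrite -(actKV s (b j)) E1 actKV.
Qed.

End Chains.

(** * The mod 2 series of a free group *)

Definition mod2_series (F : groupType) (n : nat) : set F :=
  iter n (@mod2_kernel F) setT.

Section Mod2Series.
Variables (F : groupType) (I : finType) (b : I -> F).
Hypothesis basis : free_basis b.
Local Open Scope group_scope.

Lemma mod2_series_normal n : normal_set (@mod2_series F n).
Proof. by elim: n => [|n IH]; [split|exact: mod2_kernel_normal]. Qed.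

Lemma mod2_series_decr n x : @mod2_series F n.+1 x -> @mod2_series F n x.
Proof. by case. Qed.

Lemma mod2_series_endo n (a : F -> F) : {morph a : x y / x * y} ->
  forall x, mod2_series n x -> mod2_series n (a x).
Proof. by move=> aM; elim: n => [|n IH] //=; exact: mod2_kernel_endo. Qed.

Lemma mod2_series_finite_index n : finite_index (@mod2_series F n).
Proof.
elim: n => [|n IH]; first by exists unit, (fun=> tt).
have nN := mod2_series_normal n.
have [T [q [r qrN]]] := exists_coset_space nN IH.
exact: (mod2_kernel_finite_index basis nN qrN).
Qed.

Lemma mod2_series_ball n : injective_ball b (@mod2_series F n) n.
Proof.
elim: n => [|n IH] w; first by rewrite leqn0 size_eq0 => /eqP ->; rewrite wprod_nil.
have nN := mod2_series_normal n.
have [T [q [r qrN]]] := exists_coset_space nN (mod2_series_finite_index n).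
exact: (injective_ballS basis nN qrN IH).
Qed.

Lemma mod2_series_cap x : (forall n, @mod2_series F n x) -> x = 1.
Proof.
have [w -> Kw] := basis.2 x.
exact: (@mod2_series_ball (size w)).
Qed.

(** The walls of the Cayley graph of F/M_(n+1), with M_n the mod 2 series, are
    the edges of the one of F/M_n, and z x is the set of walls that separate x
    from the base point: the chain of x. *)
Lemma exists_walls n : exists (E : finType) (z : F -> {ffun E -> bool}),
  [/\ forall x y, mod2_series n.+1 (x^-1 * y) -> z x = z y,
      forall x w, (weight (z x + z (x * wprod b w)%g)%R <= size w)%N
    & forall m x y, (m <= n)%N -> (weight (z x + z y)%R <= m)%N ->
        exists2 u, (size u <= m)%N &
          mod2_series n.+1 ((wprod b u)^-1 * (x^-1 * y))].
Proof.
have nN := mod2_series_normal n.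
have [T [q [r qrN]]] := exists_coset_space nN (mod2_series_finite_index n).
pose c := chain basis nN qrN; pose t0 := q 1.
have cM x y : (c t0 x + c t0 (x * y)%g)%R = c (act q r t0 x) y.
  rewrite /c (chainM basis nN qrN) -/c; apply/ffunP => e; rewrite !ffunE.
  by do 2!case: (c _ _ e).
exists (T * I)%type, (c t0); split=> [x y K|x w|m x y mn].
- have := cM x (x^-1 * y); rewrite mulVKg.
  rewrite [RHS](chain_mod2_kernel basis nN qrN _ K) => /ffunP cc.
  by apply/ffunP => e; have := cc e; rewrite !ffunE; do 2!case: (c _ _ e).
- by rewrite cM; exact: weight_chain.
- rewrite -{1}(mulVKg x y) cM.
  apply: short_of_weight_chain => w wm.
  exact: (mod2_series_ball (leq_trans wm mn)).
Qed.

End Mod2Series.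

(** * Finite index normal subgroups of an extension by a cyclic group *)

Lemma pigeonhole (T : finType) (f : nat -> T) :
  exists m n, (m < n)%N /\ f m = f n.
Proof.
pose g (j : 'I_#|T|.+1) := f j.
have : ~~ injectiveb g.
  by apply/injectiveP => /leq_card; rewrite card_ord ltnn.
case/injectivePn => x [y xy gxy].
have [lt|lt] := ltnP x y; first by exists x, y.
by exists y, x; split=> //; rewrite ltn_neqAle lt andbT eq_sym.
Qed.

Section Congruence.
Context {G : groupType} (N : set G).
Hypothesis nN : normal_set N.
Local Open Scope group_scope.

Definition congruent x y := N (x^-1 * y).

Lemma cong_refl x : congruent x x.
Proof. by rewrite /congruent mulVg; exact: normal_set1. Qed.

Lemma cong_sym x y : congruent x y -> congruent y x.
Proof. exact: coset_sym. Qed.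

Lemma cong_trans y x z : congruent x y -> congruent y z -> congruent x z.
Proof. exact: coset_trans. Qed.

Lemma congM x y x' y' : congruent x y -> congruent x' y' -> congruent (x * x') (y * y').
Proof.
move=> xy x'y'; have := normal_setM nN (normal_setJ nN x' xy) x'y'.
by rewrite conjgE /congruent invgM !mulgA mulgK.
Qed.

Lemma congJ x y g : congruent x y -> congruent (x ^ g) (y ^ g).
Proof. by move=> /(normal_setJ nN g); rewrite conjMg conjVg. Qed.

Lemma congV x y : congruent x y -> congruent x^-1 y^-1.
Proof.
move=> /(normal_setJ nN x^-1) /(normal_setV nN).
by rewrite conjgE /congruent !invgM !invgK !mulgA mulgK.
Qed.

Lemma congX x y n : congruent x y -> congruent (x ^+ n) (y ^+ n).
Proof.
by move=> xy; elim: n => [|n IH]; [exact: cong_refl|rewrite !expgS; exact: congM].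
Qed.

Lemma normal_setX x n : N x -> N (x ^+ n).
Proof.
move=> Nx; elim: n => [|n IH]; first exact: normal_set1.
by rewrite expgS; exact: normal_setM.
Qed.

Lemma finite_index_cover (T : finType) (r : T -> G) :
  (forall x, exists t, congruent (r t) x) -> finite_index N.
Proof.
move=> /choice[q qP]; exists T, q => x y qxy.
by apply: cong_trans (qP y); rewrite -qxy; exact: cong_sym.
Qed.

End Congruence.

Lemma finite_index_quotient (G : groupType) (K : normalSubgroup G) :
  finite_index [set x | x \in K] -> finite_set [set: quotient K].
Proof.
move=> [T [q qP]].
pose f (t : T) : quotient K :=
  xget (1%g : quotient K) [set a : quotient K | q (repr a) = t].
apply: (@sub_finite_set _ _ (f @` setT)); last exact: finite_image.
move=> a _; exists (q (repr a)) => //.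
rewrite /f; case: xgetP => [c _ /= /qP ca|/(_ a)/=]; last by move=> /(_ erefl).
by apply/eqP; rewrite -[c]reprK -[a]reprK -coset_relE.
Qed.

Section NormalSubgroupOf.
Variables (G : groupType) (N : set G) (nN : normal_set N).

Definition normal_pred : {pred G} := fun x => `[< N x >].

Lemma normal_pred1 : 1%g \in normal_pred.
Proof. by apply/asboolP; exact: normal_set1. Qed.
Lemma normal_predM : {in normal_pred &, forall u v, (u * v)%g \in normal_pred}.
Proof. by move=> x y /asboolP Nx /asboolP Ny; apply/asboolP; exact: normal_setM. Qed.
Lemma normal_predV : {in normal_pred, forall u, (u^-1)%g \in normal_pred}.
Proof. by move=> x /asboolP Nx; apply/asboolP; exact: normal_setV. Qed.
Lemma normal_predJ x y : x \in normal_pred -> (x ^ y)%g \in normal_pred.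
Proof. by move=> /asboolP Nx; apply/asboolP; exact: normal_setJ. Qed.

HB.instance Definition _ := isMulClosed.Build G normal_pred normal_predM.
HB.instance Definition _ := isMul1Closed.Build G normal_pred normal_pred1.
HB.instance Definition _ := isInvClosed.Build G normal_pred normal_predV.
HB.instance Definition _ := isConjClosed.Build G normal_pred normal_predJ.

Definition normal_subgroup : normalSubgroup G := normal_pred.

Lemma in_normal_subgroup x : (x \in normal_subgroup) = `[< N x >].
Proof. by []. Qed.

End NormalSubgroupOf.

Section Extension.
Variables (F G C : groupType).
Variables (i : {multiplicative F -> G}) (p : {multiplicative G -> C}).
Hypothesis exact_ip : short_exact i p.
Variables (I : finType) (b : I -> F).
Hypothesis basis : free_basis b.
Variables (c : C) (t : G).
Hypothesis cC : forall x, exists n : nat, x = (c ^+ n)%g \/ x = (c ^- n)%g.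
Hypothesis pt : p t = c.
Local Open Scope group_scope.

Let i_inj : injective i. Proof. by case: exact_ip. Qed.

Lemma p_i f : p (i f) = 1.
Proof.
case: exact_ip => _ E _.
have : [set g | p g = 1] (i f) by rewrite -E; exists f.
by [].
Qed.

Lemma ker_p g : p g = 1 -> exists f, g = i f.
Proof.
case: exact_ip => _ E _ pg.
have : [set g | p g = 1] g by [].
by rewrite -E => -[f _ <-]; exists f.
Qed.

Lemma p_eq g h : p g = p h -> exists f, g = h * i f.
Proof.
move=> gh; have [|f fE] := @ker_p (h^-1 * g).
  by rewrite gmulfM multV gh mulVg.
by exists f; rewrite -fE mulVKg.
Qed.

Lemma extension_fg : finitely_generated G.
Proof.
exists (t :: [seq i (b j) | j <- enum I]); set S := _ :: _ => x.
have tS : t \in S by rewrite inE eqxx.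
have bS j : i (b j) \in S by rewrite inE (map_f (fun j => i (b j))) ?orbT // mem_enum.
pose good x := exists2 w, is_word S w & x = \prod_(s <- w) s.
have goodM y z : good y -> good z -> good (y * z).
  move=> [v Sv ->] [w Sw ->]; exists (v ++ w); last by rewrite big_cat.
  by move=> s; rewrite mem_cat => /orP[/Sv|/Sw].
have good1 s : (s \in S) \/ (s^-1 \in S) -> good s.
  by move=> Ss; exists [:: s]; rewrite ?big_seq1 // => u; rewrite inE => /eqP ->.
have goodX y n : good y -> good (y ^+ n).
  move=> gy; elim: n => [|n IH]; last by rewrite expgS; exact: goodM.
  by exists [::]; rewrite ?big_nil.
have goodi f : good (i f).
  have [w ->] := basis.2 f; elim: w => [|l w IH].
    by rewrite wprod_nil mult1; exists [::]; rewrite ?big_nil.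
  rewrite wprod_cons gmulfM; apply: goodM => //; apply: good1.
  by rewrite /letter; case: l.2; rewrite ?multV ?invgK; [left|right].
have [n px] := cC (p x).
have [u gu pu] : exists2 u, good u & p u = p x.
  case: px => ->.
    by exists (t ^+ n); rewrite ?multX ?pt //; apply/goodX/good1; left.
  exists (t^-1 ^+ n); last by rewrite multX multV pt expVgn.
  by apply/goodX/good1; right; rewrite invgK.
have [f ->] := p_eq (esym pu); exact: goodM.
Qed.

(** The index is n.+1 because the walls of the n-th level are the edges of the
    Cayley graph of F modulo the n-th term of the series. *)
Definition level_kernel n : set G :=
  [set g | exists2 f, mod2_series n.+1 f & g = i f].

Lemma level_kernelE n f : level_kernel n (i f) <-> mod2_series n.+1 f.
Proof. by split=> [[f' Kf' /i_inj ->]//|Kf]; exists f. Qed.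

Lemma conj_endo g : exists2 a : F -> F,
  {morph a : x y / x * y} & forall f, i (a f) = i f ^ g.
Proof.
have /choice[a aE] : forall f, exists f', i f' = i f ^ g.
  move=> f; have [|f' ->] := @ker_p (i f ^ g); last by exists f'.
  by rewrite multJ p_i conj1g.
by exists a => // x y; apply: i_inj; rewrite aE !gmulfM !aE conjMg.
Qed.

Lemma level_kernel_normal n : normal_set (level_kernel n).
Proof.
have nN := @mod2_series_normal F n.+1.
split=> [|_ _ [f Kf ->] [f' Kf' ->]|_ [f Kf ->]|_ g [f Kf ->]].
- by exists 1; rewrite ?mult1 //; exact: normal_set1.
- by exists (f * f'); rewrite ?gmulfM //; exact: normal_setM.
- by exists f^-1; rewrite ?multV //; exact: normal_setV.
- have [a aM aE] := conj_endo g; exists (a f); rewrite ?aE //.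
  exact: (@mod2_series_endo _ n.+1 a aM).
Qed.

Lemma level_kernel_decr n g : level_kernel n.+1 g -> level_kernel n g.
Proof. by move=> [f /mod2_series_decr Kf ->]; exists f. Qed.

Lemma level_kernel_p n g : level_kernel n g -> p g = 1.
Proof. by move=> [f _ ->]; exact: p_i. Qed.

Local Notation cong n := (congruent (level_kernel n)).

Lemma cong_p n g h : cong n g h -> p g = p h.
Proof.
move=> /level_kernel_p; rewrite gmulfM multV => gh.
by rewrite -[LHS]mulg1 -gh mulVKg.
Qed.

(** The second condition makes the subgroup generated by t ^+ k meet the image of
    F inside the level kernel also when C is finite. *)
Definition central_exponent n k :=
  (forall g, cong n g (g ^ (t ^+ k))) /\
  ((exists2 m, (0 < m)%N & c ^+ m = 1) -> level_kernel n (t ^+ k)).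

Lemma central_powM n k d : (forall g, cong n g (g ^ (t ^+ k))) ->
  forall g, cong n g (g ^ (t ^+ (k * d))).
Proof.
have nK := level_kernel_normal n; move=> kC g; rewrite expgnA.
elim: d g => [|d IH] g; first by rewrite conjg1; exact: cong_refl.
by rewrite expgS conjgM; exact: cong_trans (kC g) (IH _).
Qed.

Lemma central_exponentM n k d : central_exponent n k -> central_exponent n (k * d).
Proof.
move=> [kC kK]; split=> [|/kK Kk]; first exact: central_powM.
by rewrite expgnA; apply: normal_setX => //; exact: level_kernel_normal.
Qed.

(** Two powers of t act in the same way on the finite group F/M_(n+1), so some
    power k1 > 0 acts trivially on it. When C is finite, the powers of t that lie
    in F repeat in F/M_(n+1) as well, so some t^k2 is trivial there. *)
Lemma exists_central_exponent n : exists2 k, (0 < k)%N & central_exponent n k.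
Proof.
have nK := level_kernel_normal n; have nN := @mod2_series_normal F n.+1.
have [T [q [r [qE _]]]] :=
  exists_coset_space nN (mod2_series_finite_index basis n.+1).
have congi x y : q x = q y -> cong n (i x) (i y).
  by move=> /qE xy; exists (x^-1 * y) => //; rewrite gmulfM multV.
have [k1 k1_gt0 k1C] : exists2 k, (0 < k)%N & forall g, cong n g (g ^ (t ^+ k)).
  have /choice[a aE] : forall j, exists a : F -> F,
      forall f, i (a f) = i f ^ (t ^+ j).
    by move=> j; have [a _ aE] := conj_endo (t ^+ j); exists a.
  have [j1 [j2 [lt12 /ffunP E]]] := pigeonhole (fun j => [ffun x => q (a j (b x))]).
  exists (j2 - j1)%N; rewrite ?subn_gt0 //; set u := t ^+ _.
  have ub x : cong n (i (b x)) (i (b x) ^ u).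
    have := E x; rewrite !ffunE => /congi; rewrite !aE.
    rewrite -(subnKC (ltnW lt12)) addnC expgnDr conjgM -/u.
    by move=> /(congJ nK (t ^+ j1)^-1); rewrite !conjgK.
  have uM g h : cong n g (g ^ u) -> cong n h (h ^ u) -> cong n (g * h) ((g * h) ^ u).
    by rewrite conjMg; exact: congM.
  have uV g : cong n g (g ^ u) -> cong n g^-1 (g^-1 ^ u).
    by rewrite conjVg; exact: congV.
  have uX g j : cong n g (g ^ u) -> cong n (g ^+ j) ((g ^+ j) ^ u).
    by rewrite conjXg; exact: congX.
  have ut : cong n t (t ^ u).
    have -> : t ^ u = t by apply/conjg_fixP; rewrite commgXg.
    exact: cong_refl.
  have ui f : cong n (i f) (i f ^ u).
    have [w ->] := basis.2 f; elim: w => [|l w IH].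
      by rewrite wprod_nil mult1 conj1g; exact: cong_refl.
    rewrite wprod_cons gmulfM; apply: uM => //.
    by rewrite /letter; case: l.2; rewrite ?multV //; exact: uV.
  move=> g; have [m px] := cC (p g).
  case: px => pg.
    have [|f ->] := @p_eq g (t ^+ m); first by rewrite multX pt.
    exact/uM/ui/uX.
  have [|f ->] := @p_eq g (t ^- m); first by rewrite multV multX pt.
  exact/uM/ui/uV/uX.
have [k2 k2_gt0 k2K] : exists2 k, (0 < k)%N &
    (exists2 m, (0 < m)%N & c ^+ m = 1) -> level_kernel n (t ^+ k).
  have [[m m_gt0 cm]|nofin] := pselect (exists2 m, (0 < m)%N & c ^+ m = 1).
    2: by exists 1%N.
  have [|f fE] := @ker_p (t ^+ m); first by rewrite multX pt.
  have [j1 [j2 [lt12 /congi]]] := pigeonhole (fun j => q (f ^+ j)).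
  rewrite !multX -fE -!expgnA => E.
  exists (m * (j2 - j1))%N; first by rewrite muln_gt0 m_gt0 subn_gt0.
  have : level_kernel n ((t ^+ (m * j1))^-1 * t ^+ (m * j2)) by [].
  by rewrite -{1}(subnKC (ltnW lt12)) mulnDr expgnDr mulKg.
exists (k1 * k2)%N; rewrite ?muln_gt0 ?k1_gt0 //; split=> [|/k2K K2].
  exact: central_powM.
by rewrite mulnC expgnA; exact: normal_setX.
Qed.

(** When k is a central exponent, this is the subgroup generated by the level
    kernel and t^k: up to the level kernel g is the power of t^k with exponent
    x - y, an integer written as a difference of natural numbers. *)
Definition power_kernel n k : set G :=
  [set g | exists x y, cong n (g * t ^+ (k * y)) (t ^+ (k * x))].

Lemma power_kernel_normal n k : central_exponent n k -> normal_set (power_kernel n k).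
Proof.
have nK := level_kernel_normal n.
move=> [kC _]; split=> [|g h [x [y gxy]] [x' [y' hxy]]|g [x [y gxy]]|g h [x [y gxy]]].
- by exists 0%N, 0%N; rewrite mul1g; exact: cong_refl.
- exists (x + x')%N, (y' + y)%N; rewrite mulnDr expgnDr mulgA -(mulgA g h).
  apply: (@cong_trans _ _ nK (g * t ^+ (k * x') * t ^+ (k * y))).
    by apply: congM; [|apply: congM|]; rewrite // ?cong_refl //; exact: cong_refl.
  rewrite -mulgA -expgnDr addnC expgnDr mulgA mulnDr expgnDr.
  by apply: congM => //; exact: cong_refl.
- exists y, x; apply: (@cong_trans _ _ nK (g^-1 * (g * t ^+ (k * y)))).
    by apply: congM; [|exact: cong_refl|exact: cong_sym].
  by rewrite mulKg; exact: cong_refl.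
- have uh z : cong n (t ^+ (k * z)) (t ^+ (k * z) ^ h).
    rewrite expgnA conjXg; apply: congX => //.
    have := cong_sym nK (kC h); congr (level_kernel n _).
    by rewrite !conjgE !invgM invgK !mulgA.
  exists x, y; apply: (@cong_trans _ _ nK (t ^+ (k * x) ^ h)); last exact: cong_sym.
  apply: (@cong_trans _ _ nK ((g * t ^+ (k * y)) ^ h)); last exact: congJ.
  by rewrite conjMg; apply: congM => //; exact: cong_refl.
Qed.

Lemma power_kernel_p n k g : power_kernel n k g ->
  exists x y, p g * c ^+ (k * y) = c ^+ (k * x).
Proof. by move=> [x [y /cong_p]]; rewrite gmulfM !multX pt; exists x, y. Qed.

Lemma level_kernel_power n k g : level_kernel n g -> power_kernel n k g.
Proof.
have nK := level_kernel_normal n; move=> Kg; exists 0%N, 0%N.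
by rewrite muln0 mulg1 /congruent mulg1; exact: normal_setV.
Qed.

Lemma power_kernelX n k m : power_kernel n k (t ^+ (k * m)).
Proof.
have nK := level_kernel_normal n.
by exists m, 0%N; rewrite muln0 mulg1; exact: cong_refl.
Qed.

Lemma power_kernel_decr n k d g :
  power_kernel n.+1 (k * d) g -> power_kernel n k g.
Proof.
move=> [x [y gxy]]; exists (d * x)%N, (d * y)%N; rewrite !mulnA.
exact: level_kernel_decr.
Qed.

Lemma cyclic_dichotomy : (exists2 m, (0 < m)%N & c ^+ m = 1) \/
  injective (fun m => c ^+ m).
Proof.
case: (pselect (exists2 m, (0 < m)%N & c ^+ m = 1)) => [|inf]; [by left|right].
have le m n : (m <= n)%N -> c ^+ m = c ^+ n -> m = n.
  move=> mn E; apply/eqP; rewrite eqn_leq mn leqNgt; apply/negP => lt.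
  apply: inf; exists (n - m)%N; first by rewrite subn_gt0.
  by rewrite expgnFr // E mulgV.
move=> m n E; have [/le|/ltnW/le/(_ (esym E))->//] := leqP m n.
exact.
Qed.

Lemma power_kernel_i n k f : (0 < k)%N -> central_exponent n k ->
  power_kernel n k (i f) <-> mod2_series n.+1 f.
Proof.
have nK := level_kernel_normal n.
move=> k_gt0 [_ kK]; rewrite -level_kernelE; split=> [[x [y fxy]]|]; last first.
  exact: level_kernel_power.
suff : cong n (t ^+ (k * x)) (t ^+ (k * y)).
  move=> xy; have := congM nK (cong_trans nK fxy xy) (cong_refl nK (t ^- (k * y))).
  by rewrite mulgK mulgV => /(cong_sym nK); rewrite /congruent invg1 mul1g.
have [/kK Kk|inj] := cyclic_dichotomy.
  rewrite !expgnA; apply: normal_setM => //; last exact: normal_setX.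
  by apply: normal_setV => //; exact: normal_setX.
have := cong_p fxy; rewrite gmulfM p_i mul1g !multX pt => /inj ->.
exact: cong_refl.
Qed.

Lemma power_kernel_finite_index n k : (0 < k)%N -> central_exponent n k ->
  finite_index (power_kernel n k).
Proof.
have nK := level_kernel_normal n; have nN := @mod2_series_normal F n.+1.
move=> k_gt0 kC; have nP := power_kernel_normal kC.
have [T [q [r [qE rK]]]] :=
  exists_coset_space nN (mod2_series_finite_index basis n.+1).
apply: (@finite_index_cover _ _ nP _ (fun z : T * 'I_k => t ^+ z.2 * i (r z.1))).
(* Elements above nonnegative powers of c; multiplying by a power of t^k, which
   does not change the class, brings the others to this case. *)
have pos x m : p x = c ^+ m ->
    exists z : T * 'I_k, congruent (power_kernel n k) (t ^+ z.2 * i (r z.1)) x.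
  move=> px; have [|f ->] := @p_eq x (t ^+ m); first by rewrite multX pt.
  exists (q f, Ordinal (ltn_pmod m k_gt0)) => /=.
  apply: (congM nP); last first.
    apply: level_kernel_power; rewrite -multV -gmulfM.
    by apply/level_kernelE/qE; rewrite rK.
  rewrite {2}(divn_eq m k) addnC expgnDr /congruent mulKg mulnC.
  exact: power_kernelX.
move=> x; have [m [/pos//|px]] := cC (p x).
have [|z zx] := pos (x * t ^+ (k * m)) (k.-1 * m)%N.
  rewrite gmulfM multX pt px -[in (k * m)%N](prednK k_gt0) mulSn expgnDr mulKg //.
exists z; apply: (cong_trans nP zx); apply: (cong_sym nP).
by rewrite /congruent mulKg; exact: power_kernelX.
Qed.

(** Each exponent divides the next one, so that the subgroups are nested, and the
    n-th one exceeds n, so that when C is infinite the image of K_n in C, which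
    is generated by c ^+ k n, omits any given nontrivial element for large n.
    When C is finite these images are trivial. *)
Lemma exists_box_subgroups : exists K : nat -> normalSubgroup G,
  [/\ forall n, {subset K n.+1 <= K n},
      forall n, finite_index [set x | x \in K n],
      forall n f, i f \in K n <-> mod2_series n.+1 f
    & forall g, p g <> 1 ->
        exists n0, forall n x, (n0 <= n)%N -> x \in K n -> p x <> p g].
Proof.
have /choice[k0 k0P] : forall n, exists k, (0 < k)%N /\ central_exponent n k.
  by move=> n; have [k] := exists_central_exponent n; exists k.
pose k n := (\prod_(j < n.+1) (k0 j * j.+1))%N.
have kS n : k n.+1 = (k n * (k0 n.+1 * n.+2))%N by rewrite /k big_ord_recr.
have k_gt n : (n < k n)%N.
  rewrite /k big_ord_recr /= mulnCA; apply: (@leq_trans (n.+1)) => //.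
  rewrite mulnA; apply: leq_pmull; rewrite muln_gt0 (k0P n).1 /=.
  by apply: prodn_gt0 => j; rewrite muln_gt0 (k0P j).1.
have kC n : central_exponent n (k n).
  rewrite /k big_ord_recr /= mulnCA; exact/central_exponentM/(k0P n).2.
pose K n := normal_subgroup (power_kernel_normal (kC n)).
have k_gt0 n : (0 < k n)%N by exact: leq_ltn_trans (k_gt n).
exists K; split=> [n x|n|n f|g pg].
- rewrite !in_normal_subgroup => /asboolP Kx; apply/asboolP.
  by rewrite kS in Kx; exact: power_kernel_decr Kx.
- have [T [q qP]] := power_kernel_finite_index (k_gt0 n) (kC n).
  by exists T, q => x y /qP Kxy; exact/asboolP.
- rewrite in_normal_subgroup; split=> [/asboolP/power_kernel_i|Kf]; first exact.
  exact/asboolP/power_kernel_i.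
have [fin|inj] := cyclic_dichotomy.
  exists 0%N => n x _ /asboolP Kx px; apply: pg; rewrite -px.
  case: Kx => x1 [x2] /cong_p; rewrite gmulfM.
  have p1 y : p (t ^+ (k n * y)) = 1.
    rewrite expgnA; apply: level_kernel_p.
    by apply: normal_setX; [exact: level_kernel_normal|exact: (kC n).2].
  by rewrite !p1 mulg1.
have nodvd n x y m : (m <= n)%N -> c ^+ (m + k n * y) = c ^+ (k n * x) -> m = 0%N.
  move=> mn /inj E; have : (k n %| m)%N.
    by rewrite -(dvdn_addl _ (dvdn_mulr y (dvdnn (k n)))) E dvdn_mulr.
  case: m mn {E} => // m mn /dvdn_leq -/(_ isT).
  by rewrite leqNgt (leq_ltn_trans mn (k_gt n)).
have [m pgm] := cC (p g); exists m => n x mn /asboolP /power_kernel_p[x1 [x2 E]] px.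
apply: pg; rewrite px in E.
suff m0 : m = 0%N by rewrite m0 in pgm; case: pgm => ->; rewrite ?invg1.
case: pgm => pgm; rewrite pgm in E.
  by apply: (@nodvd n x1 x2 m) => //; rewrite expgnDr.
by apply: (@nodvd n x2 x1 m) => //; rewrite expgnDr -E mulVKg.
Qed.

End Extension.

(** * Almost invariant finite sets in a cyclic group *)

Lemma count_iota_lt e m : (count (fun j => j < e) (iota 0 m) <= e)%N.
Proof.
rewrite -size_filter -[X in (_ <= X)%N](size_iota 0); apply: uniq_leq_size.
  exact/filter_uniq/iota_uniq.
by move=> j; rewrite mem_filter !mem_iota /= add0n => /andP[].
Qed.

Lemma count_iota_ge e m : (count (fun j => m <= e + j) (iota 0 m) <= e)%N.
Proof.
rewrite -size_filter -[X in (_ <= X)%N](size_iota (m - e)); apply: uniq_leq_size.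
  exact/filter_uniq/iota_uniq.
move=> j; rewrite mem_filter !mem_iota /= add0n leq_subLR => /andP[-> jm].
by apply: leq_trans jm _; rewrite addnC -leq_subLR.
Qed.

Section Folner.
Variables (G C : groupType) (p : {multiplicative G -> C}) (c : C) (t : G).
Hypothesis cC : forall x, exists n : nat, x = (c ^+ n)%g \/ x = (c ^- n)%g.
Hypothesis pt : p t = c.
Local Open Scope group_scope.

(** When C is infinite, T is a long interval of powers of t; otherwise T
    represents every element of C. *)
Lemma exists_folner (S : seq G) (d : nat) : exists T : seq G,
  [/\ (0 < size T)%N, uniq (map p T)
    & {in S, forall s,
        (d * count (fun a => p (s * a)%g \notin map p T) T <= size T)%N}].
Proof.
have pX j : p (t ^+ j) = c ^+ j by rewrite multX pt.
have [[m m_gt0 cm]|inj] := cyclic_dichotomy c.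
  pose D := undup [seq c ^+ j | j <- iota 0 m].
  have powD j : c ^+ j \in D.
    rewrite mem_undup (divn_eq j m) expgnDr mulnC expgnA cm expg1n mul1g.
    by apply: map_f; rewrite mem_iota ltn_mod.
  have inD x : x \in D.
    have [j [->|->]] := cC x; first exact: powD.
    suff -> : c ^- j = c ^+ (m.-1 * j) by [].
    apply: (@mulgI _ (c ^+ j)); rewrite mulgV -expgnDr -mulSn prednK //.
    by rewrite expgnA cm expg1n.
  have [T pT] : exists T, map p T = D.
    elim: (D) => [|x D0 [T TD]]; first by exists [::].
    have [j [->|->]] := cC x; [exists (t ^+ j :: T)|exists (t ^- j :: T)];
      by rewrite /= ?multV pX TD.
  exists T; split; rewrite ?pT ?undup_uniq //.
    by rewrite -(size_map p) pT; move: (inD c); case: (D).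
  move=> s _; rewrite (@eq_count _ _ pred0) ?count_pred0 ?muln0 //.
  by move=> a /=; rewrite inD.
have [e Se] : exists e, {in S, forall s, exists2 j, (j <= e)%N &
    p s = c ^+ j \/ p s = c ^- j}.
  elim: S => [|s S [e Se]]; first by exists 0%N.
  have [j ps] := cC (p s); exists (maxn j e) => u; rewrite inE => /orP[/eqP ->|/Se].
    by exists j; rewrite ?leq_maxl.
  by move=> [j' je pu]; exists j'; rewrite ?leq_max ?je ?orbT.
pose L := (d * e).+1; pose T := [seq t ^+ j | j <- iota 0 L].
have pT : map p T = [seq c ^+ j | j <- iota 0 L].
  by rewrite -map_comp; apply: eq_map => j /=.
have inT m : (c ^+ m \in [seq c ^+ j | j <- iota 0 L]) = (m < L)%N.
  exact: etrans (mem_map inj (iota 0 L) m) (mem_iota 0 L m).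
exists T; rewrite pT size_map size_iota; split=> //.
  by rewrite map_inj_uniq ?iota_uniq.
move=> s /Se[j je ps]; apply: leq_trans (leqnSn _); rewrite leq_mul2l.
apply/orP; right; apply: leq_trans je; rewrite count_map.
case: ps => ps.
  apply: leq_trans (count_iota_ge j L); apply: sub_count => a /=.
  by rewrite gmulfM ps pX -expgnDr inT -leqNgt.
apply: leq_trans (count_iota_lt j L).
rewrite -!size_filter; apply: uniq_leq_size; first exact/filter_uniq/iota_uniq.
move=> a; rewrite !mem_filter => /andP[+ aL]; rewrite aL andbT /= ltnNge.
apply: contra => ja; rewrite gmulfM ps pX -(subnKC ja) expgnDr mulKg.
rewrite inT; apply: leq_ltn_trans (leq_subr _ _) _.
by move: aL; rewrite mem_iota.
Qed.

End Folner.

Local Open Scope ring_scope.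

(** * Squared distances between vectors of finite dimension *)

Section Euclidean.
Variable R : realType.

(** Squares of distances are used rather than distances because they add up
    under direct sums. *)
Definition euclidean (X : Type) (k : X -> X -> R) : Prop :=
  exists (Y : finType) (f : X -> Y -> R),
    forall x y, k x y = \sum_u (f x u - f y u) ^+ 2.

Lemma euclidean0 (X : Type) : euclidean (fun _ _ : X => 0).
Proof. by exists void, (fun _ _ => 0) => x y; rewrite big1 // => -[]. Qed.

Lemma euclideanD (X : Type) (k k' : X -> X -> R) :
  euclidean k -> euclidean k' -> euclidean (fun x y => k x y + k' x y).
Proof.
move=> [Y [f kf]] [Y' [f' kf']].
exists (Y + Y')%type, (fun x u => match u with inl v => f x v | inr v => f' x v end).
by move=> x y; rewrite big_sumType /= kf kf'.
Qed.

Lemma euclidean_comp (X X' : Type) (h : X' -> X) (k : X -> X -> R) :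
  euclidean k -> euclidean (fun x y => k (h x) (h y)).
Proof. by move=> [Y [f kf]]; exists Y, (f \o h) => x y; exact: kf. Qed.

Lemma euclidean_ge0 (X : Type) (k : X -> X -> R) x y : euclidean k -> 0 <= k x y.
Proof. by move=> [Y [f ->]]; apply: sumr_ge0 => u _; exact: sqr_ge0. Qed.

Lemma euclidean_refl (X : Type) (k : X -> X -> R) x : euclidean k -> k x x = 0.
Proof. by move=> [Y [f ->]]; rewrite big1 // => u _; rewrite subrr expr0n. Qed.

Lemma euclidean_sym (X : Type) (k : X -> X -> R) x y : euclidean k -> k x y = k y x.
Proof. by move=> [Y [f kf]]; rewrite !kf; apply: eq_bigr => u _; rewrite -sqrrN opprB. Qed.

(** The triangle inequality in squared form, optimal when the two sides are as
    1 to n: this is the case met when a path of length n gets one more step. *)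
Lemma euclidean_triangle (X : Type) (k : X -> X -> R) (n : nat) x y z : euclidean k ->
  n%:R * k x z <= n.+1%:R * (n%:R * k x y + k y z).
Proof.
move=> [Y [f kf]]; rewrite !kf !mulr_sumr -big_split mulr_sumr /=.
apply: ler_sum => u _; rewrite -natr1.
have := sqr_ge0 (n%:R * (f x u - f y u) - (f y u - f z u)).
set a := f x u; set b := f y u; set c := f z u; set m := n%:R.
by move=> ?; nra.
Qed.

Lemma euclidean_path (G : groupType) (k : G -> G -> R) (d : R) (w : seq G) x :
  euclidean k -> (forall y s, s \in w -> k y (y * s)%g <= d) ->
  k x (x * \prod_(s <- w) s)%g <= (size w)%:R ^+ 2 * d.
Proof.
move=> ek; elim: w x => [|s w IH] x kd.
  by rewrite big_nil mulg1 euclidean_refl // expr0n mul0r.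
have xs : k x (x * s)%g <= d by apply: kd; exact: mem_head.
have d_ge0 : 0 <= d := le_trans (euclidean_ge0 _ _ ek) xs.
rewrite big_cons mulgA.
have := IH (x * s)%g (fun y s' sw => kd y s' (@mem_behead _ (s :: w) _ sw)).
case: w {IH kd} => [|s' w] IH; first by rewrite big_nil mulg1 expr1n mul1r.
set z := (x * s * \big[_/_]_(j <- _) _)%g in IH *; set n := size _ in IH.
have n_gt0 : 0 < n%:R :> R by rewrite ltr0n.
rewrite -[size _]/n.+1 -(ler_pM2l n_gt0).
apply: (le_trans (euclidean_triangle n x (x * s)%g z ek)).
rewrite -natr1; set m := n%:R in n_gt0 IH *.
have -> : m * ((m + 1) ^+ 2 * d) = (m + 1) * (m * d + m ^+ 2 * d) by ring.
by rewrite ler_wpM2l ?lerD // ?ler_wpM2l // ltW // ltr_wpDl // ltW.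
Qed.

(** The tensor product over all walls of one of two unit vectors of the plane
    with inner product kappa, according to whether z contains the wall; A
    indexes the coordinates of the tensor product. *)
Definition wall_vector (kappa : R) (E : finType) (z A : {ffun E -> bool}) : R :=
  \prod_e (if z e then if A e then Num.sqrt (1 - kappa ^+ 2) else kappa
           else (~~ A e)%:R).

Lemma wall_vector_dot kappa (E : finType) (z z' : {ffun E -> bool}) :
  0 <= kappa <= 1 ->
  \sum_A wall_vector kappa z A * wall_vector kappa z' A = kappa ^+ weight (z + z').
Proof.
move=> /andP[k0 k1]; rewrite /wall_vector.
under eq_bigr do rewrite -big_split /=.
pose g e a : R :=
  (if z e then if a then Num.sqrt (1 - kappa ^+ 2) else kappa else (~~ a)%:R) *
  (if z' e then if a then Num.sqrt (1 - kappa ^+ 2) else kappa else (~~ a)%:R).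
rewrite -(bigA_distr_bigA g) /weight -prodr_const [RHS]big_mkcond /=.
apply: eq_bigr => e _; rewrite big_bool /g inE ffunE /=.
have sq : Num.sqrt (1 - kappa ^+ 2) * Num.sqrt (1 - kappa ^+ 2) = 1 - kappa ^+ 2.
  by rewrite -expr2 sqr_sqrtr // subr_ge0 expr_le1.
by case: (z e); case: (z' e); rewrite /= ?sq; ring.
Qed.

End Euclidean.

Section WordBall.
Variables (G : groupType) (S : seq G).
Local Open Scope group_scope.

Definition word_ball (n : nat) (x : G) : Prop :=
  exists2 w, is_word S w /\ (size w <= n)%N & x = \prod_(s <- w) s.

Lemma word_ball_le m n x : (m <= n)%N -> word_ball m x -> word_ball n x.
Proof. by move=> mn [w [Sw wm] xw]; exists w => //; split=> //; exact: leq_trans mn. Qed.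

Lemma word_ballM m n x y : word_ball m x -> word_ball n y -> word_ball (m + n) (x * y).
Proof.
move=> [v [Sv vm] ->] [w [Sw wn] ->]; exists (v ++ w); last by rewrite big_cat.
split; last by rewrite size_cat leq_add.
by move=> s; rewrite mem_cat => /orP[/Sv|/Sw].
Qed.

Hypothesis genS : generates S.

Lemma word_ball_exists x : exists n, word_ball n x.
Proof. by have [w Sw ->] := genS x; exists (size w), w. Qed.

Lemma word_ball_seq (xs : seq G) : exists n, {in xs, forall x, word_ball n x}.
Proof.
elim: xs => [|x xs [n xsn]]; first by exists 0%N.
have [m xm] := word_ball_exists x; exists (maxn m n) => y.
rewrite inE => /orP[/eqP ->|/xsn]; first exact: word_ball_le (leq_maxl _ _) xm.
exact/word_ball_le/leq_maxr.
Qed.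

End WordBall.

(** * Unit vectors attached to the cosets of one level *)

Section CosetVectors.
Variables (R : realType) (F G C : groupType).
Variables (i : {multiplicative F -> G}) (p : {multiplicative G -> C}).
Hypothesis exact_ip : short_exact i p.
Variables (K : set G) (nK : normal_set K) (E : finType) (z : F -> {ffun E -> bool}).
Hypothesis zK : forall x y, K (i (x^-1 * y))%g -> z x = z y.
Variables (Q : finType) (q : G -> Q).
Hypothesis qK : forall x y, q x = q y -> K (x^-1 * y)%g.
Variable kappa : R.
Hypothesis kappa01 : 0 <= kappa <= 1.
Local Open Scope group_scope.

Local Notation cong := (congruent K).

(* The preimage in G of the image of K in C, that is, the product of K and the
   image of F. *)
Let H : set G := [set g | exists2 x, K x & p x = p g].

Lemma preimage_normal : normal_set H.
Proof.
split=> [|x y [x' Kx xx] [y' Ky yy]|x [x' Kx xx]|x y [x' Kx xx]].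
- by exists 1; rewrite ?mult1 //; exact: normal_set1.
- by exists (x' * y'); rewrite ?gmulfM ?xx ?yy //; exact: normal_setM.
- by exists x'^-1; rewrite ?multV ?xx //; exact: normal_setV.
- by exists (x' ^ y); rewrite ?multJ ?xx //; exact: normal_setJ.
Qed.

Lemma preimageP g : H g -> exists f, cong (i f) g.
Proof.
move=> [x Kx xg]; have [f ->] := p_eq exact_ip (esym xg); exists f.
by have := normal_setJ nK (i f) Kx; rewrite conjgE.
Qed.

Let base := coset_rep H.

Lemma base_eq x y : H (x^-1 * y) -> base x = base y.
Proof. exact: (coset_rep_eq preimage_normal). Qed.

Lemma exists_fiber_part x : exists f, cong (i f) ((base x)^-1 * x).
Proof.
apply: preimageP; apply: coset_sym preimage_normal _.
exact: coset_repP preimage_normal.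
Qed.

Let fiber_part x : F := projT1 (cid (exists_fiber_part x)).

Lemma fiber_partP x : cong (i (fiber_part x)) ((base x)^-1 * x).
Proof. exact: projT2 (cid (exists_fiber_part x)). Qed.

Lemma z_fiber_part x f : cong (i f) ((base x)^-1 * x) -> z (fiber_part x) = z f.
Proof.
move=> xf; apply: zK; rewrite gmulfM multV.
exact: (cong_trans nK (fiber_partP x) (cong_sym nK xf)).
Qed.

(** Each class x = base x * i f of G/K gets the wall vector of f, placed in a
    summand of its own for each coset of F, so that vectors at distinct cosets
    are orthogonal. *)
Definition coset_vector (x : G) (u : Q * {ffun E -> bool}) : R :=
  ((u.1 == q (base x))%:R * wall_vector kappa (z (fiber_part x)) u.2)%R.

Definition coset_dot (x y : G) : R :=
  (\sum_u coset_vector x u * coset_vector y u)%R.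

Lemma coset_dotE x y : coset_dot x y =
  ((q (base x) == q (base y))%:R *
   kappa ^+ weight (z (fiber_part x) + z (fiber_part y)))%R.
Proof.
rewrite -wall_vector_dot //.
have -> : ((q (base x) == q (base y))%:R =
    \sum_(a : Q) ((a == q (base x))%:R * (a == q (base y))%:R) :> R)%R.
  rewrite (bigD1 (q (base x))) //= eqxx mul1r big1 ?addr0 //.
  by move=> a /negbTE ->; rewrite mul0r.
rewrite big_distrlr /= pair_bigA /=.
by apply: eq_bigr => u _; rewrite /coset_vector mulrACA.
Qed.

Lemma coset_dot_ge0 x y : (0 <= coset_dot x y)%R.
Proof.
by rewrite coset_dotE mulr_ge0 ?ler0n // exprn_ge0 //; case/andP: kappa01.
Qed.

Lemma coset_vector_eq x y : cong x y -> coset_vector x =1 coset_vector y.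
Proof.
move=> xy u; have bxy : base x = base y.
  by apply: base_eq; exists (x^-1 * y).
rewrite /coset_vector bxy (@z_fiber_part x (fiber_part y)) //.
apply: (cong_trans nK (fiber_partP y)); rewrite bxy.
by apply: congM => //; [exact: cong_refl|exact: cong_sym].
Qed.

Lemma coset_dot_same x : coset_dot x x = 1%R.
Proof.
rewrite coset_dotE eqxx mul1r; set w := (_ + _)%R.
have -> : weight w = 0%N; last exact: expr0.
by apply: eq_card0 => e; rewrite !inE ffunE; case: (z _ e).
Qed.

Lemma coset_dot_neq0 x y : coset_dot x y != 0%R ->
  exists2 g, K g & p g = p (x^-1 * y).
Proof.
rewrite coset_dotE; have [/qK bb _|] := eqVneq (q _) (q _); last by rewrite mul0r eqxx.
have nH := preimage_normal.
have Hbb : H ((base x)^-1 * base y) by exists ((base x)^-1 * base y).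
have [g Kg pg] : H (x^-1 * y).
  apply: (coset_trans nH (coset_repP x nH)); apply: (coset_trans nH Hbb).
  by apply: coset_sym => //; exact: coset_repP.
by exists g.
Qed.

Lemma coset_dot_right x f l : (forall f', weight (z f' + z (f' * f)%g)%R <= l)%N ->
  (kappa ^+ l <= coset_dot x (x * i f))%R.
Proof.
move=> fl; have bxf : base x = base (x * i f).
  by apply: base_eq; exists 1; [exact: normal_set1|rewrite mulKg p_i // mult1].
rewrite coset_dotE -bxf eqxx mul1r (@z_fiber_part (x * i f) (fiber_part x * f)).
  by case/andP: kappa01 => k0 k1; apply: ler_wiXn2l.
rewrite gmulfM -bxf mulgA; apply: congM => //; last exact: cong_refl.
exact: fiber_partP.
Qed.

Lemma coset_dot_far x y m : (kappa ^+ m < coset_dot x y)%R ->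
  exists f f', cong (i (f^-1 * f')) (x^-1 * y) /\ (weight (z f + z f')%R <= m)%N.
Proof.
move=> lt; have k0 : (0 <= kappa)%R by case/andP: kappa01.
have dot0 : coset_dot x y != 0%R.
  by rewrite gt_eqF //; apply: le_lt_trans lt; exact: exprn_ge0.
exists (fiber_part x), (fiber_part y); split; last first.
  rewrite leqNgt; apply/negP => /ltnW mw; move: lt; rewrite ltNge => /negP; apply.
  rewrite coset_dotE; case/andP: kappa01 => _ k1.
  apply: (@le_trans _ _ (kappa ^+ weight (z (fiber_part x) + z (fiber_part y)))%R).
    by rewrite ler_piMl ?exprn_ge0 //; case: (_ == _); rewrite ?ler01.
  exact: ler_wiXn2l.
have bxy : base x = base y.
  have [g Kg pg] := coset_dot_neq0 dot0.
  by apply: base_eq; exists g.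
rewrite gmulfM multV.
have := congM nK (congV nK (fiber_partP x)) (fiber_partP y).
by rewrite bxy invgM invgK -mulgA mulVKg.
Qed.

Section Average.
Variable T : seq G.
Hypotheses (T_gt0 : (0 < size T)%N) (T_uniq : uniq (map p T)).
Hypothesis T_sep : {in T &, forall a a' x, K x -> p x = p (a^-1 * a') -> p a = p a'}.

Local Notation L := ((size T)%:R : R)%R.

(** A vector of unit length, as the classes x * a lie in distinct cosets of F for
    a in T. It varies slowly with x since T is almost invariant modulo F. *)
Definition average_vector (x : G) u : R :=
  ((\sum_(a <- T) coset_vector (x * a) u) / Num.sqrt L)%R.

Definition average_dist (x y : G) : R :=
  (\sum_u (average_vector x u - average_vector y u) ^+ 2)%R.

Lemma average_dist_euclidean : euclidean average_dist.
Proof. by exists (Q * {ffun E -> bool})%type, average_vector. Qed.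

Lemma average_dist_eq x y y' : cong y y' -> average_dist x y = average_dist x y'.
Proof.
move=> yy'; apply: eq_bigr => u _; congr ((_ - _) ^+ 2)%R.
rewrite /average_vector; congr (_ / _)%R; apply: eq_bigr => a _.
by apply: coset_vector_eq; apply: congM => //; exact: cong_refl.
Qed.

Definition average_dot x y : R :=
  ((\sum_(a <- T) \sum_(a' <- T) coset_dot (x * a)%g (y * a')%g) / L)%R.

Lemma average_dotE x y :
  average_dot x y = (\sum_u average_vector x u * average_vector y u)%R.
Proof.
have sL : (Num.sqrt L * Num.sqrt L = L :> R)%R by rewrite -expr2 sqr_sqrtr ?ler0n.
rewrite /average_vector; under [RHS]eq_bigr => u _.
  rewrite mulrACA -invfM sL big_distrlr /=; over.
rewrite -mulr_suml exchange_big /=; congr (_ / _)%R.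
by apply: eq_bigr => a _; rewrite exchange_big.
Qed.

Lemma average_dot_same x : average_dot x x = 1%R.
Proof.
have L0 : (L != 0 :> R)%R by rewrite pnatr_eq0 -lt0n.
have uT := map_uniq T_uniq.
apply: (canLR (mulfK L0)); rewrite mul1r.
rewrite big_seq (eq_bigr (fun=> 1%R)) => [|a aT].
  by rewrite -big_seq big_const_seq count_predT iter_addr addr0.
rewrite (bigD1_seq a) //= coset_dot_same big_seq_cond big1 ?addr0 //.
move=> a' /andP[a'T aa']; apply/eqP; apply: contraTT aa' => /coset_dot_neq0[g Kg].
rewrite invgM -mulgA mulKg negbK => pg; apply/eqP.
have := T_sep aT a'T Kg pg; move/(congr1 (index^~ (map p T))).
rewrite -(nth_index 1 aT) -(nth_index 1 a'T).
rewrite -!(nth_map 1 1 p) ?index_mem // !index_uniq ?size_map ?index_mem //.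
by move=> ->.
Qed.

Lemma average_distE x y : average_dist x y = (2 - 2 * average_dot x y)%R.
Proof.
have -> : (2 - 2 * average_dot x y =
    average_dot x x + average_dot y y - 2 * average_dot x y)%R.
  by rewrite !average_dot_same; ring.
rewrite !average_dotE mulr_sumr -big_split -sumrB; apply: eq_bigr => u _ /=.
by ring.
Qed.

(** For all but a proportion 1/d of the a in T, the vectors at x s a and x a' are
    attached to points of one coset of F that are separated by at most l walls;
    all other inner products are nonnegative. *)
Lemma average_dot_right x s (l d : nat) :
  (forall a a', a \in T -> a' \in T -> p (s * a) = p a' ->
     exists2 f, s * a = a' * i f &
       forall f', (weight (z f' + z (f' * f)%g)%R <= l)%N) ->
  (d * count (fun a => p (s * a)%g \notin map p T) T <= size T)%N ->
  (d%:R * average_dot x (x * s) >= (d%:R - 1) * kappa ^+ l)%R.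
Proof.
move=> near bad; have k0 : (0 <= kappa)%R by case/andP: kappa01.
have L0 : (0 < L :> R)%R by rewrite ltr0n.
rewrite /average_dot mulrA ler_pdivlMr //; set good := fun a => p (s * a) \in map p T.
have lower : ((count good T)%:R * kappa ^+ l <=
    \sum_(a <- T) \sum_(a' <- T) coset_dot (x * a)%g (x * s * a')%g)%R.
  rewrite exchange_big /= -sum1_count natr_sum mulr_suml big_mkcond /=.
  rewrite big_seq [leRHS]big_seq; apply: ler_sum => a aT.
  case: ifP => [/mapP[a' a'T pa']|_]; last by apply: sumr_ge0 => ? _; exact: coset_dot_ge0.
  rewrite mul1r (bigD1_seq a') ?(map_uniq T_uniq) //=.
  have [f sa fl] := near a a' aT a'T pa'.
  apply: (@le_trans _ _ (coset_dot (x * a') (x * a' * i f))).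
    exact: coset_dot_right.
  by rewrite -!mulgA -sa lerDl; apply: sumr_ge0 => ? _; exact: coset_dot_ge0.
have gb : (d * count good T + size T >= d * size T)%N.
  by rewrite -[in leqLHS](count_predC good T) mulnDr leq_add2l.
apply: (@le_trans _ _ (d%:R * ((count good T)%:R * kappa ^+ l))%R); last exact: ler_wpM2l.
rewrite mulrAC mulrA ler_wpM2r ?exprn_ge0 // mulrBl mul1r lerBlDr.
by rewrite -!natrM -natrD ler_nat.
Qed.

(** At distance less than 1 the inner product exceeds 1/2, so one of its
    (size T)^2 terms exceeds 1 / (2 size T), hence kappa ^+ m. *)
Lemma average_dist_far x y m : (2 * L * kappa ^+ m < 1)%R ->
  (average_dist x y < 1)%R -> exists a a' f f',
    [/\ a \in T, a' \in T, cong (a * i (f^-1 * f') * a'^-1) (x^-1 * y)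
      & (weight (z f + z f')%R <= m)%N].
Proof.
move=> km; rewrite average_distE => near.
have L0 : (0 < L :> R)%R by rewrite ltr0n.
have [[a [a' [aT a'T /coset_dot_far[f [f' [ff' fm]]]]]]|small] :=
    pselect (exists a a', [/\ a \in T, a' \in T &
      (kappa ^+ m < coset_dot (x * a) (y * a'))%R]).
  exists a, a', f, f'; split=> //.
  have := congM nK (congM nK (cong_refl nK a) ff') (cong_refl nK a'^-1).
  by rewrite invgM !mulgA mulgV mul1g mulgK.
have : (\sum_(a <- T) \sum_(a' <- T) coset_dot (x * a)%g (y * a')%g <=
        \sum_(a <- T) \sum_(a' <- T) kappa ^+ m)%R.
  rewrite big_seq [leRHS]big_seq; apply: ler_sum => a aT.
  rewrite big_seq [leRHS]big_seq; apply: ler_sum => a' a'T.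
  by rewrite leNgt; apply/negP => lt; apply: small; exists a, a'.
rewrite !big_const_seq !count_predT !iter_addr !addr0 => le.
have : (1 / 2 < average_dot x y)%R by lra.
rewrite /average_dot ltr_pdivlMr // ltNge => /negP; case.
apply: (le_trans le); rewrite -mulrnA -[leLHS]mulr_natl natrM.
by move: km L0; set e := (kappa ^+ m)%R; set l := L; move=> *; nra.
Qed.

End Average.
End CosetVectors.

(** * A kernel for each scale *)

Lemma bounded_on (X : eqType) (xs : seq X) (f : X -> nat) :
  exists n, {in xs, forall x, (f x <= n)%N}.
Proof. by exists (\max_(x <- xs) f x)%N => x xxs; exact: leq_bigmax_seq. Qed.

Lemma bernoulli (R : realType) (h : R) n : 0 <= h <= 1 -> 1 - n%:R * h <= (1 - h) ^+ n.
Proof.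
move=> /andP[h0 h1]; elim: n => [|n IH]; first by rewrite mul0r subr0 expr0.
rewrite exprS -natr1; apply: (@le_trans _ _ ((1 - h) * (1 - n%:R * h))); last first.
  by rewrite ler_wpM2l // subr_ge0.
by have := mulr_ge0 (ler0n R n) (sqr_ge0 h); nra.
Qed.

Lemma normal_subgroup_set (G : groupType) (K : normalSubgroup G) :
  normal_set [set x | x \in K].
Proof.
split=> [|x y|x|x y] /=; [exact: normal1|exact: normalM|exact: normalV|exact: normalJ].
Qed.

Section ScaleKernels.
Variables (R : realType) (F G C : groupType).
Variables (i : {multiplicative F -> G}) (p : {multiplicative G -> C}).
Hypothesis exact_ip : short_exact i p.
Variables (I : finType) (b : I -> F).
Hypothesis basis : free_basis b.
Variables (c : C) (t : G).
Hypothesis cC : forall x, exists n : nat, x = (c ^+ n)%g \/ x = (c ^- n)%g.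
Hypothesis pt : p t = c.
Variable K : nat -> normalSubgroup G.
Hypothesis K_index : forall n, finite_index [set x | x \in K n].
Hypothesis K_i : forall n f, i f \in K n <-> mod2_series n.+1 f.
Hypothesis K_sep : forall g, p g <> 1%g ->
  exists n0, forall n x, (n0 <= n)%N -> x \in K n -> p x <> p g.
Variable S : seq G.
Hypothesis genS : generates S.

(** The parameters are chosen in this order: T almost invariant up to
    4/d <= delta, then kappa so close to 1 that the wall vectors hardly change
    under the finitely many elements of F that compare S T with T, then m such
    that m walls make the inner products small. All of this is independent of n,
    which only has to be large enough for T to inject into C modulo the image of
    K_n and for the girth of the n-th Cayley graph of F to exceed m. *)
Lemma exists_scale_kernel (delta : R) : 0 < delta ->
  exists n0 r, forall n, (n0 <= n)%N ->
  exists k : G -> G -> R, [/\ euclidean k,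
    forall x y y', (y^-1 * y')%g \in K n -> k x y = k x y',
    forall x s, s \in S -> k x (x * s)%g <= delta
  & forall x y, k x y < 1 ->
      exists2 g, word_ball S r g & (g^-1 * (x^-1 * y))%g \in K n].
Proof.
move=> delta_gt0.
have [d d_gt0 d_delta] : exists2 d, (0 < d)%N & 4 <= d%:R * delta.
  have := archi_boundP (divr_ge0 (ler0n R 4) (ltW delta_gt0)).
  rewrite ltr_pdivrMr // => /ltW dd; exists (Num.bound (4 / delta)) => //.
have [T [T_gt0 T_uniq T_bad]] := exists_folner cC pt S d.
have [l lP] : exists l, forall s a a', s \in S -> a \in T -> a' \in T ->
    p (s * a)%g = p a' ->
    exists2 u, (size u <= l)%N & (s * a = a' * i (wprod b u))%g.
  have /choice[f fP] : forall v : G * G, exists l, p v.1 = p v.2 ->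
      exists2 u, (size u <= l)%N & (v.1 = v.2 * i (wprod b u))%g.
    move=> [g a']; have [pga|pga] := pselect (p g = p a'); last by exists 0%N.
    have [f ->] := p_eq exact_ip pga; have [u ->] := basis.2 f.
    by exists (size u) => _; exists u.
  have [l ll] := bounded_on
    [seq (g, a') | g <- [seq (s * a)%g | s <- S, a <- T], a' <- T] f.
  exists l => s a a' sS aT a'T /(fP (_, _))[u ul ua]; exists u => //.
  by apply: leq_trans ul _; apply: ll; do 2?apply: allpairs_f.
have [kappa [k0 k1 kl]] : exists kappa : R,
    [/\ 0 <= kappa, kappa < 1 & 1 - d%:R^-1 <= kappa ^+ l].
  pose h : R := (d * l.+1)%:R^-1.
  have dl : (0 < (d * l.+1)%:R :> R) by rewrite ltr0n muln_gt0 d_gt0.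
  have h1 : h <= 1 by rewrite invf_le1 // ler1n muln_gt0 d_gt0.
  have h0 : 0 < h by rewrite invr_gt0.
  exists (1 - h); split; [by rewrite subr_ge0|lra|].
  apply: le_trans (bernoulli l _); last by rewrite ltW.
  rewrite lerD2l lerN2 /h natrM invfM mulrCA ler_piMr ?invr_ge0 ?ler0n //.
  by rewrite ler_pdivrMr ?ltr0n // mul1r ler_nat.
have kappa01 : 0 <= kappa <= 1 by rewrite k0 ltW.
have [m km] : exists m, 2 * (size T)%:R * kappa ^+ m < 1.
  have k_abs : `|kappa| < 1 by rewrite ger0_norm.
  have L0 : 0 < 2 * (size T)%:R :> R by rewrite mulr_gt0 ?ltr0n.
  have /cvgrPdist_lt/(_ (2 * (size T)%:R)^-1) := cvg_expr k_abs.
  rewrite invr_gt0 => /(_ L0)[m _ /(_ m (leqnn m))] /=.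
  rewrite sub0r normrN ger0_norm ?exprn_ge0 // => km.
  by exists m; rewrite -ltr_pdivlMl // mulr1.
have [rT rTP] := word_ball_seq genS (T ++ [seq a^-1%g | a <- T]).
have [rb rbP] := word_ball_seq genS
  [seq i (letter b l) | l <- [seq (j, e) | j <- enum I, e <- [:: true; false]]].
have ballu u : word_ball S (rb * size u) (i (wprod b u)).
  elim: u => [|l' u IH]; first by rewrite wprod_nil mult1; exists [::]; rewrite ?big_nil.
  rewrite wprod_cons gmulfM /= mulnS; apply: word_ballM => //; apply: rbP.
  apply: (map_f (fun l => i (letter b l))); case: l' => j e.
  by apply: allpairs_f; rewrite ?mem_enum //; case: e.
have /choice[sep sepP] : forall g, exists n0, p g <> 1%g ->
    forall n x, (n0 <= n)%N -> x \in K n -> p x <> p g.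
  move=> g; have [pg|/K_sep[n0 n0P]] := pselect (p g = 1%g); first by exists 0%N.
  by exists n0.
have [ns nsP] := bounded_on [seq (a^-1 * a')%g | a <- T, a' <- T] sep.
exists (maxn m ns), (rT + rb * m + rT)%N => n; rewrite geq_max => /andP[mn nsn].
have nK := normal_subgroup_set (K n).
have [E [z [z_inv z_lip z_far]]] := exists_walls basis n.
have [Q [q qK]] := K_index n.
have zK x y : [set x | x \in K n] (i (x^-1 * y)%g) -> z x = z y.
  by move=> /K_i; exact: z_inv.
have T_sep : {in T &, forall a a' x, [set x | x \in K n] x ->
    p x = p (a^-1 * a')%g -> p a = p a'}.
  move=> a a' aT a'T x Kx px; apply: contrapT => aa'.
  have /sepP/(_ n x) : p (a^-1 * a')%g <> 1%g.
    by move=> pa1; apply: aa'; rewrite -[a'](mulVKg a) gmulfM pa1 mulg1.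
  apply=> //; apply: leq_trans nsn; apply: nsP; exact: allpairs_f.
have kE := average_distE exact_ip nK z qK kappa01 T_gt0 T_uniq T_sep.
exists (average_dist exact_ip nK z q kappa T); split.
- exact: average_dist_euclidean.
- exact: (average_dist_eq exact_ip nK zK q).
- move=> x s sS; rewrite kE.
  have near a a' : a \in T -> a' \in T -> p (s * a)%g = p a' ->
     exists2 f, (s * a = a' * i f)%g &
       forall f', (weight (z f' + z (f' * f)%g)%R <= l)%N.
    move=> aT a'T paa; have [u ul ->] := lP s a a' sS aT a'T paa.
    by exists (wprod b u) => // f'; exact: leq_trans (z_lip _ _) ul.
  have := average_dot_right exact_ip nK zK q kappa01 T_gt0 T_uniq x near (T_bad s sS).
  set D := average_dot _ _ _ _ _ _ _ _.
  have d0 : 0 < d%:R :> R by rewrite ltr0n.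
  have d1 : 1 <= d%:R :> R by rewrite ler1n.
  have dV : d%:R * d%:R^-1 = 1 :> R by rewrite mulfV // gt_eqF.
  move=> le; rewrite -(ler_pM2l d0).
  apply: le_trans d_delta; set v := d%:R^-1 in kl dV.
  have v0 : 0 <= v by rewrite invr_ge0 ltW.
  have d10 : 0 <= d%:R - 1 :> R by rewrite subr_ge0.
  have := ler_wpM2l d10 kl; set e := kappa ^+ l in le *.
  have -> : (d%:R - 1) * (1 - v) = d%:R - 1 - d%:R * v + v by ring.
  rewrite dV => kl'; lra.
- move=> x y /(average_dist_far qK kappa01 T_gt0 T_uniq T_sep km).
  move=> [a [a' [f [f' [aT a'T ff' fm]]]]].
  have [u um uK] := z_far _ _ _ mn fm.
  exists (a * i (wprod b u) * a'^-1)%g.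
    apply: word_ballM; last by apply: rTP; rewrite mem_cat map_f ?orbT.
    apply: word_ballM; first by apply: rTP; rewrite mem_cat aT.
    by apply: word_ball_le (ballu u); rewrite leq_mul2l um orbT.
  apply: (cong_trans nK _ ff'); apply: congM => //; last exact: cong_refl.
  apply: congM => //; first exact: cong_refl.
  by rewrite /congruent -multV -gmulfM; exact/K_i.
Qed.

End ScaleKernels.

(** * The levels of the box space *)

Section WordLength.
Variables (G : groupType) (S : seq G).

Lemma word_length_spec x : (exists2 w, is_word S w & x = (\prod_(s <- w) s)%g) ->
  (exists2 w, is_word S w /\ size w = word_length S x & x = (\prod_(s <- w) s)%g) /\
  forall w, is_word S w -> x = (\prod_(s <- w) s)%g -> (word_length S x <= size w)%N.
Proof.
move=> [w Sw xw].
pose lengths := [set n | exists2 w, is_word S w /\ size w = n & x = (\prod_(s <- w) s)%g].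
have ex : exists n, `[< lengths n >] by exists (size w); apply/asboolP; exists w.
have [n /asboolP ln nmin] := ex_minnP ex.
have : [set n | lengths n /\ forall m, lengths m -> (n <= m)%N] (word_length S x).
  by apply: xgetPex; exists n; split=> // m lm; apply: nmin; exact/asboolP.
by case=> lx lmin; split=> // v Sv xv; apply: lmin; exists v.
Qed.

Lemma word_ball_length n x : word_ball S n x -> (word_length S x <= n)%N.
Proof.
move=> [w [Sw wn] xw]; have [|_ /(_ w Sw xw)] := @word_length_spec x.
  by exists w.
by move=> /leq_trans; apply.
Qed.

End WordLength.

Section Levels.
Variables (R : realType) (G : groupType) (K : nat -> normalSubgroup G) (S : seq G).
Hypothesis genS : generates S.

Local Notation proj n x := (\pi_(quotient (K n)) x : quotient (K n)).
Local Notation Sbar n := (map \pi_(quotient (K n)) S).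
Local Notation d := (level_dist R S (K := K)).

Lemma pi_eq n (x y : G) : (x^-1 * y)%g \in K n -> \pi_(quotient (K n)) x = \pi y.
Proof. by move=> xy; apply/eqP; rewrite -coset_relE. Qed.

Lemma pi_eqV n (x y : G) : \pi_(quotient (K n)) x = \pi y -> (x^-1 * y)%g \in K n.
Proof. by move/eqP; rewrite -coset_relE. Qed.

Lemma piM n (x y : G) : proj n (x * y)%g = (proj n x * proj n y)%g.
Proof. exact: Defs.pi_mul. Qed.

Lemma piV n (x : G) : proj n (x^-1)%g = ((proj n x)^-1)%g.
Proof. exact: Defs.pi_inv. Qed.

Lemma pi1 n : proj n 1%g = 1%g.
Proof. by rewrite /1%g /= /quotient_one; unlock. Qed.

Lemma word_ball_pi n r x : word_ball S r x -> word_ball (Sbar n) r (proj n x).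
Proof.
move=> [w [Sw wr] ->]; exists (map \pi_(quotient (K n)) w); last first.
  by rewrite big_map (big_morph _ (@piM n) (pi1 n)).
split; last by rewrite size_map.
move=> _ /mapP[s /Sw + ->]; rewrite -piV => -[Ss|Ss]; [left|right]; exact: map_f.
Qed.

Lemma generates_pi n : generates (Sbar n).
Proof.
move=> x; have [m /(word_ball_pi n)] := word_ball_exists genS (repr x).
by rewrite reprK => -[w [Sw _] xw]; exists w.
Qed.

(** The kernel at two points of G/K_n is bounded along a word between them; by
    invariance, a letter may be applied to the representatives. *)
Lemma descend_kernel n (k : G -> G -> R) delta r : euclidean k ->
  (forall x y y', (y^-1 * y')%g \in K n -> k x y = k x y') ->
  (forall x s, s \in S -> k x (x * s)%g <= delta) ->
  (forall x y, k x y < 1 ->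
      exists2 g, word_ball S r g & (g^-1 * (x^-1 * y))%g \in K n) ->
  exists k' : quotient (K n) -> quotient (K n) -> R,
    [/\ euclidean k', forall a b, k' a b <= d a b ^+ 2 * delta
      & forall a b, r%:R < d a b -> 1 <= k' a b].
Proof.
move=> ek kK kS kfar; exists (fun a b => k (repr a) (repr b)).
have ek' := euclidean_comp (fun a : quotient (K n) => repr a) ek.
split=> // [a b|a b rab].
  have [[w [Sw wE] abw] _] := word_length_spec (generates_pi (n := n) (a^-1 * b)%g).
  have -> : b = (a * \prod_(s <- w) s)%g by rewrite -abw mulVKg.
  rewrite /level_dist /word_dist mulKg -[in leRHS]abw -wE.
  apply: (euclidean_path (G := quotient (K n)) a ek') => y s /Sw.
  have step (y' : quotient (K n)) s' : s' \in S ->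
      k (repr y') (repr (y' * proj n s')%g) <= delta.
    move=> Ss; rewrite -(kK _ (repr y' * s')%g) ?kS //.
    by apply: pi_eqV; rewrite piM !reprK.
  case=> /mapP[s' Ss' sE]; first by rewrite sE; exact: step.
  rewrite (euclidean_sym _ _ ek) -{2}[y](mulgK s) sE; exact: step.
rewrite leNgt; apply/negP => /kfar[g Sg gab].
have gE : proj n g = (a^-1 * b)%g.
  by rewrite (pi_eq gab) piM piV !reprK.
move: rab; rewrite /level_dist /word_dist ltr_nat ltnNge => /negP; apply.
by rewrite -gE; apply: word_ball_length; exact: word_ball_pi.
Qed.

Hypothesis K_finite : forall n, finite_set [set: quotient (K n)].

Lemma level_dist_bounded n : exists B : nat, forall a b : quotient (K n), d a b <= B%:R.
Proof.
have /finite_seqP[s sE] := K_finite n.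
have [B Bs] := bounded_on s (word_length (Sbar n)); exists B => a b.
rewrite /level_dist /word_dist ler_nat; apply: Bs.
have : [set: quotient (K n)] (a^-1 * b)%g by [].
by rewrite sE.
Qed.

Lemma level_dist_diam n (a b : quotient (K n)) : d a b <= level_diam R S K n.
Proof.
apply: ub_le_sup; last by exists (a, b).
by have [B dB] := level_dist_bounded n; exists B%:R => _ [z _ <-]; exact: dB.
Qed.

Hypothesis scale : forall delta : R, 0 < delta -> exists n0 r, forall n, (n0 <= n)%N ->
  exists k : quotient (K n) -> quotient (K n) -> R,
    [/\ euclidean k, forall a b, k a b <= d a b ^+ 2 * delta
      & forall a b, r%:R < d a b -> 1 <= k a b].

(** The n-th level uses those of the scales 0, ..., n that are available there,
    with delta = 2 ^- j.+1 at scale j so that the sum stays below the square of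
    the distance. The first m scales are all available except at finitely many
    levels, which have bounded diameter. *)
Lemma exists_level_kernels :
  exists k : forall n, quotient (K n) -> quotient (K n) -> R,
  [/\ forall n, euclidean (k n),
      forall n a b, k n a b <= d a b ^+ 2
    & forall m : nat, exists D : R, forall n (a b : quotient (K n)),
        D < d a b -> m%:R <= k n a b].
Proof.
have /choice[N /choice[r rP]] : forall j, exists n0 r, forall n, (n0 <= n)%N ->
    exists k : quotient (K n) -> quotient (K n) -> R,
    [/\ euclidean k, forall a b, k a b <= d a b ^+ 2 * (2^-1) ^+ j.+1
      & forall a b, r%:R < d a b -> 1 <= k a b].
  by move=> j; apply: scale; rewrite exprn_gt0 // invr_gt0.
have sums n m : exists k : quotient (K n) -> quotient (K n) -> R,
    [/\ euclidean k, forall a b, k a b <= d a b ^+ 2 * (1 - (2^-1) ^+ m)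
      & forall a b, \sum_(j < m) ((N j <= n)%N && ((r j)%:R < d a b))%:R <= k a b].
  elim: m => [|m [k [ek kd kr]]].
    exists (fun _ _ => 0); split=> [|a b|a b]; first exact: euclidean0.
      by rewrite expr0 subrr mulr0.
    by rewrite big_ord0.
  have [Nn|nN] := leqP (N m) n; last first.
    exists k; split=> // a b.
      apply: le_trans (kd a b) _; rewrite ler_wpM2l ?sqr_ge0 // lerD2l lerN2.
      by rewrite exprS ler_piMl ?exprn_ge0 ?invr_ge0 // invf_le1 // ler1n.
    by rewrite big_ord_recr /= leqNgt nN addr0.
  have [k' [ek' kd' kr']] := rP m n Nn.
  exists (fun a b => k a b + k' a b); split=> [|a b|a b]; first exact: euclideanD.
    apply: le_trans (lerD (kd a b) (kd' a b)) _.
    rewrite -mulrDr ler_wpM2l ?sqr_ge0 // exprS.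
    by set e := (2^-1 ^+ m : R); lra.
  rewrite big_ord_recr /= Nn /=; apply: lerD => //.
  by case: ltP => [/kr'//|_]; exact: euclidean_ge0.
pose k n := projT1 (cid (sums n n.+1)).
have kP n := projT2 (cid (sums n n.+1)) : [/\ euclidean (k n), _ & _].
exists k; split=> [n|n a b|m].
- by have [] := kP n.
- have [_ kd _] := kP n; apply: le_trans (kd a b) _.
  rewrite -[leRHS]mulr1 ler_wpM2l ?sqr_ge0 // lerBlDr lerDl.
  by rewrite exprn_ge0 // invr_ge0.
have [N' N'P] := bounded_on (iota 0 m) N.
have [r' r'P] := bounded_on (iota 0 m) r.
have /choice[B BP] := level_dist_bounded.
have [B' B'P] := bounded_on (iota 0 (maxn N' m)) B.
exists (maxn r' B')%:R => n a b Dab.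
have [_ _ kr] := kP n; apply: le_trans (kr a b).
have [nN|] := leqP (maxn N' m) n; last first.
  move=> nN; exfalso; move: Dab; rewrite ltNge => /negP; apply.
  apply: le_trans (BP n a b) _; rewrite ler_nat leq_max B'P ?orbT //.
  by rewrite mem_iota.
move: nN; rewrite geq_max => /andP[N'n mn].
rewrite -(big_mkord xpredT (fun j => ((N j <= n)%N && ((r j)%:R < d a b))%:R)).
rewrite (big_cat_nat (n := m)) //=; last exact: leqW.
rewrite -[leLHS]addr0; apply: lerD; last by apply: sumr_ge0 => j _; exact: ler0n.
rewrite big_nat (eq_bigr (fun=> 1)) => [|j /andP[_ jm]].
  by rewrite -big_nat sumr_const_nat subn0.
have jm' : j \in iota 0 m by rewrite mem_iota.
rewrite (leq_trans (N'P j jm') N'n) (le_lt_trans _ Dab) //.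
by rewrite ler_nat leq_max r'P.
Qed.

End Levels.

(** * Embedding of the box space into the Hilbert space *)

Section FiniteSupport.
Variable R : realType.

Lemma series_finite_support (u : nat -> R) N : (forall j, (N <= j)%N -> u j = 0) ->
  series u @ \oo --> (\sum_(j < N) u j : R).
Proof.
move=> u0; apply: cvg_near_cst; exists N => // m /= Nm.
rewrite /series /= -(big_mkord xpredT u) (big_cat_nat (n := N)) //=.
by rewrite [X in _ + X]big_nat [X in _ + X]big1 ?addr0 // => j /andP[/u0].
Qed.

Lemma sum_finite_support (u : nat -> R) M N : (forall j, (M <= j)%N -> u j = 0) ->
  (M <= N)%N -> \sum_(j < N) u j = \sum_(j < M) u j.
Proof.
move=> u0 MN; rewrite -!(big_mkord xpredT u) (big_cat_nat (n := M)) //=.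
by rewrite [X in _ + X]big_nat [X in _ + X]big1 ?addr0 // => j /andP[/u0].
Qed.

Definition finite_ell2 (u : nat -> R) N (u0 : forall j, (N <= j)%N -> u j = 0) : ell2 R.
Proof.
exists u; apply/cvg_ex; exists (\sum_(j < N) u j ^+ 2).
by apply: series_finite_support => j /u0 ->; rewrite expr0n.
Defined.

Lemma ell2_dist_finite (x y : ell2 R) N :
  (forall j, (N <= j)%N -> sval x j = 0) -> (forall j, (N <= j)%N -> sval y j = 0) ->
  ell2_dist x y = Num.sqrt (\sum_(j < N) (sval x j - sval y j) ^+ 2).
Proof.
move=> x0 y0; rewrite /ell2_dist; congr Num.sqrt; apply/cvg_lim => //.
by apply: series_finite_support => j Nj; rewrite x0 ?y0 // subrr expr0n.
Qed.

Lemma euclidean_seq (X : Type) (k : X -> X -> R) (x0 : X) : euclidean k ->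
  exists v : X -> nat -> R, exists N, [/\ forall x j, (N <= j)%N -> v x j = 0,
    forall j, v x0 j = 0 & forall x y, k x y = \sum_(j < N) (v x j - v y j) ^+ 2].
Proof.
move=> [Y [f kf]].
pose v x j := if insub j is Some o then
  f x (enum_val (o : 'I_#|Y|)) - f x0 (enum_val o) else 0.
exists v, #|Y|; split=> [x j Yj|j|x y]; rewrite /v.
- by rewrite insubF // ltnNge Yj.
- by case: insub => // o; rewrite subrr.
- rewrite kf (reindex _ (onW_bij _ (enum_val_bij Y))) /=.
  by apply: eq_bigr => o _; rewrite valK; congr (_ ^+ 2); ring.
Qed.

(** The lower control function at t is the infimum of the distances between
    images of points at distance at least t, and of t itself in case there are no
    such points. *)
Lemma coarsely_embeds_lipschitz (X Y : Type) (dX : X -> X -> R) (dY : Y -> Y -> R)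
    (f : X -> Y) (L : R) : 0 < L ->
  (forall x x', 0 <= dX x x') -> (forall y y', 0 <= dY y y') ->
  (forall x x', dY (f x) (f x') <= L * dX x x') ->
  (forall m : nat, exists D : R, forall x x', D < dX x x' -> m%:R <= dY (f x) (f x')) ->
  coarsely_embeds dX dY.
Proof.
move=> L0 dX0 dY0 upper lower.
pose A t := [set s | s = t \/ exists x x', t <= dX x x' /\ s = dY (f x) (f x')].
have A0 t : 0 <= t -> lbound (A t) 0 by move=> t0 s [->|[x [x' [_ ->]]]].
have Ane t : A t !=set0 by exists t; left.
have infA t s : 0 <= t -> A t s -> inf (A t) <= s.
  by move=> t0; apply: ge_inf; exists 0; exact: A0.
exists f, (fun t => inf (A t)), (fun t => L * t); split.
- split=> [t t0|s t s0 st|].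
  + exact: lb_le_inf (A0 _ t0).
  + apply: lb_le_inf => // _ [->|[x [x' [tx ->]]]].
      by apply: le_trans st; apply: infA => //; left.
    by apply: infA => //; right; exists x, x'; split=> //; exact: le_trans tx.
  + apply/cvgryPge => M.
    have [D DP] := lower (Num.bound `|M|).
    exists (Num.max D (Num.max M 0)); split; first exact: num_real.
    move=> t; rewrite !gt_max => /and3P[Dt Mt t0].
    apply: lb_le_inf => // _ [->|[x [x' [tx ->]]]]; first exact: ltW.
    apply: le_trans (DP x x' (lt_le_trans Dt tx)).
    by apply: le_trans (ler_norm M) _; apply: ltW; exact: archi_boundP.
- split=> [t t0|s t s0 st|]; first exact: mulr_ge0 (ltW L0) t0.
    by rewrite ler_pM2l.
  apply/cvgryPge => M; exists (M / L); split; first exact: num_real.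
  by move=> t; rewrite ltr_pdivrMr // mulrC => /ltW.
- move=> x x'; rewrite upper andbT; apply: infA => //.
  by right; exists x, x'.
Qed.

End FiniteSupport.

Section BoxEmbedding.
Variables (R : realType) (G : groupType) (K : nat -> normalSubgroup G) (S : seq G).
Variable gap : nat -> R.
Hypothesis gapP : admissible_gaps S K gap.
Hypothesis diamP : forall n (a b : quotient (K n)),
  level_dist R S a b <= level_diam R S K n.
Variable k : forall n, quotient (K n) -> quotient (K n) -> R.
Hypothesis k_euclidean : forall n, euclidean (@k n).
Hypothesis k_upper : forall n a b, @k n a b <= level_dist R S a b ^+ 2.
Hypothesis k_lower : forall m : nat, exists D : R, forall n (a b : quotient (K n)),
  D < level_dist R S a b -> m%:R <= k a b.

Local Notation d := (level_dist R S (K := K)).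
Local Notation dist := (@box_dist R G S K gap).

Let v_spec n := cid (euclidean_seq (1%g : quotient (K n)) (k_euclidean n)).
Let v n : quotient (K n) -> nat -> R := projT1 (v_spec n).
Let dim n : nat := projT1 (cid (projT2 (v_spec n))).

Lemma v_dim n (a : quotient (K n)) j : (dim n <= j)%N -> v a j = 0.
Proof. by have [H _ _] := projT2 (cid (projT2 (v_spec n))); exact: H. Qed.

Lemma v1 n j : @v n 1%g j = 0.
Proof. by have [_ H _] := projT2 (cid (projT2 (v_spec n))); exact: H. Qed.

Lemma v_dist n (a b : quotient (K n)) : k a b = \sum_(j < dim n) (v a j - v b j) ^+ 2.
Proof. by have [_ _ H] := projT2 (cid (projT2 (v_spec n))); exact: H. Qed.

Lemma v_dist_le n (a b : quotient (K n)) N : (dim n <= N)%N ->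
  \sum_(j < N) (v a j - v b j) ^+ 2 = k a b.
Proof.
move=> nN; rewrite v_dist.
apply: (@sum_finite_support R (fun j => (v a j - v b j) ^+ 2)) => // j nj.
by rewrite !v_dim // subrr expr0n.
Qed.

Lemma v_norm_le n (a : quotient (K n)) N : (dim n <= N)%N ->
  \sum_(j < N) v a j ^+ 2 <= d a 1%g ^+ 2.
Proof.
move=> nN; apply: le_trans (k_upper _ _); rewrite -(v_dist_le _ _ nN).
by apply: ler_sum => j _; rewrite v1 subr0.
Qed.

(** The first coordinate separates the levels. The other coordinates are shared
    by all levels: overlaps between the images of distinct levels do no harm. *)
Definition box_coord (a : box_space K) (j : nat) : R :=
  if j is j'.+1 then v (tagged a) j' else \sum_(0 <= l < tag a) gap l.

Lemma box_coord_dim a j : ((dim (tag a)).+1 <= j)%N -> box_coord a j = 0.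
Proof. by case: j => // j; exact: v_dim. Qed.

Definition box_map (a : box_space K) : ell2 R := finite_ell2 (@box_coord_dim a).

Lemma box_map_dist a b N : (dim (tag a) <= N)%N -> (dim (tag b) <= N)%N ->
  ell2_dist (box_map a) (box_map b) =
  Num.sqrt ((\sum_(0 <= l < tag a) gap l - \sum_(0 <= l < tag b) gap l) ^+ 2 +
            \sum_(j < N) (v (tagged a) j - v (tagged b) j) ^+ 2).
Proof.
move=> aN bN; rewrite (@ell2_dist_finite _ _ _ N.+1).
- by rewrite big_ord_recl.
- by move=> j Nj; apply: box_coord_dim; exact: leq_trans Nj.
- by move=> j Nj; apply: box_coord_dim; exact: leq_trans Nj.
Qed.

Lemma ell2_dist_sym (x y : ell2 R) : ell2_dist x y = ell2_dist y x.
Proof.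
congr (Num.sqrt (limn (series _))); apply/funext => n.
by rewrite -sqrrN opprB.
Qed.

Lemma gap_gt n (a b : quotient (K n)) : d a b < gap n.
Proof. by apply: le_lt_trans (diamP a b) _; have := gapP n; rewrite gt_max => /andP[]. Qed.

Lemma gap_gtS n (a b : quotient (K n.+1)) : d a b < gap n.
Proof. by apply: le_lt_trans (diamP a b) _; have := gapP n; rewrite gt_max => /andP[]. Qed.

Lemma d_ge0 n (a b : quotient (K n)) : 0 <= d a b.
Proof. exact: ler0n. Qed.

Lemma gap_ge0 n : 0 <= gap n.
Proof.
exact: ltW (le_lt_trans (d_ge0 1%g 1%g) (gap_gt (1%g : quotient (K n)) 1%g)).
Qed.

Lemma v_norm_leV n (a : quotient (K n)) N : (dim n <= N)%N ->
  \sum_(j < N) v a j ^+ 2 <= d 1%g a ^+ 2.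
Proof.
move=> nN; apply: le_trans (k_upper _ _); rewrite -(v_dist_le _ _ nN).
by apply: ler_sum => j _; rewrite v1 sub0r sqrrN.
Qed.

Lemma sum_gap_ge m l n : (m <= l < n)%N -> gap l <= \sum_(m <= l < n) gap l.
Proof.
move=> /andP[ml ln]; rewrite (big_cat_nat (n := l)) ?(ltnW ln) //=.
rewrite [X in _ + X]big_ltn // addrCA lerDl.
by apply: addr_ge0; apply: sumr_ge0 => j _; exact: gap_ge0.
Qed.

(** The sum of the gaps between two levels dominates the diameters of both, so it
    is comparable to the distance of their points. *)
Lemma cross_dist_bounds a b : (tag a < tag b)%N ->
  let g := \sum_(tag a <= l < tag b) gap l in
  [/\ g <= ell2_dist (box_map a) (box_map b),
      ell2_dist (box_map a) (box_map b) <= 2 * cross_dist S gap a b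
    & cross_dist S gap a b <= 3 * g].
Proof.
case: a b => [m x] [n y] /= mn; rewrite /cross_dist /=.
set g := \sum_(m <= l < n) gap l.
have g_ge0 : 0 <= g by apply: sumr_ge0 => l _; exact: gap_ge0.
have dx : d x 1%g <= g.
  by apply: le_trans (ltW (gap_gt _ _)) _; apply: sum_gap_ge; rewrite leqnn.
have dy : d 1%g y <= g.
  case: n mn y @g g_ge0 dx => // n mn y g _ _.
  by apply: le_trans (ltW (gap_gtS _ _)) _; apply: sum_gap_ge; rewrite ltnSn andbT.
have dx0 := d_ge0 x 1%g; have dy0 := d_ge0 1%g y.
pose N := maxn (dim m) (dim n).
have mN : (dim m <= N)%N by exact: leq_maxl.
have nN : (dim n <= N)%N by exact: leq_maxr.
rewrite (@box_map_dist (existT _ m x) (existT _ n y) N) //=.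
have -> : (\sum_(0 <= l < m) gap l - \sum_(0 <= l < n) gap l) ^+ 2 = g ^+ 2.
  rewrite (big_cat_nat (n := m) (p := n)) ?(ltnW mn) //= -/g.
  by rewrite opprD addrA subrr sub0r sqrrN.
set s := \sum_(j < N) _.
have s0 : 0 <= s by apply: sumr_ge0 => j _; exact: sqr_ge0.
have sle : s <= 2 * d x 1%g ^+ 2 + 2 * d 1%g y ^+ 2.
  apply: (@le_trans _ _
    (2 * (\sum_(j < N) v x j ^+ 2) + 2 * (\sum_(j < N) v y j ^+ 2))).
    rewrite !mulr_sumr -big_split; apply: ler_sum => j _ /=.
    by have := sqr_ge0 (v x j + v y j); nra.
  by rewrite lerD // ler_pM2l // ?v_norm_le ?v_norm_leV.
split.
- by rewrite -[leLHS]ger0_norm // -sqrtr_sqr ler_wsqrtr // lerDl.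
- have c0 : 0 <= 2 * (d x 1%g + g + d 1%g y) by lra.
  rewrite -[leRHS]ger0_norm // -sqrtr_sqr ler_wsqrtr //.
  by move: (d x 1%g) (d 1%g y) dx0 dy0 sle => e e' *; nra.
- lra.
Qed.

Lemma box_coarsely_embeds : coarsely_embeds dist (@ell2_dist R).
Proof.
have same n (x y : quotient (K n)) :
    ell2_dist (box_map (existT _ n x)) (box_map (existT _ n y)) = Num.sqrt (k x y).
  rewrite (@box_map_dist (existT _ n x) (existT _ n y) (dim n)) //=.
  by rewrite subrr expr0n add0r v_dist_le.
have cross_ge0 a b : 0 <= cross_dist S gap a b.
  rewrite /cross_dist addr_ge0 ?d_ge0 // addr_ge0 ?d_ge0 //.
  by apply: sumr_ge0 => l _; exact: gap_ge0.
apply: (@coarsely_embeds_lipschitz _ _ _ _ _ box_map 2) => //.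
- by move=> a b; rewrite /box_dist; case: ifP => // _; case: ifP => // _; exact: d_ge0.
- by move=> x y; exact: sqrtr_ge0.
- move=> [m x] [n y]; rewrite /box_dist /=.
  have [mn|nm|mn] := ltngtP m n.
  + by have [] := @cross_dist_bounds (existT _ m x) (existT _ n y) mn.
  + rewrite ell2_dist_sym.
    by have [] := @cross_dist_bounds (existT _ n y) (existT _ m x) nm.
  + subst n; rewrite tagged_asE same; have d0 := d_ge0 x y.
    apply: (@le_trans _ _ (d x y)); last by rewrite ler_peMl // ler1n.
    by rewrite -[leRHS]ger0_norm // -sqrtr_sqr ler_wsqrtr.
- move=> l; have [D DP] := k_lower (l ^ 2).
  exists (Num.max D (3 * l%:R)) => -[m x] [n y]; rewrite /box_dist /= gt_max.
  have [mn|nm|mn] := ltngtP m n.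
  + have [lo _ up] := @cross_dist_bounds (existT _ m x) (existT _ n y) mn.
    by move=> /andP[_ /lt_le_trans/(_ up)]; rewrite ltr_pM2l // => /ltW/le_trans; apply.
  + rewrite ell2_dist_sym.
    have [lo _ up] := @cross_dist_bounds (existT _ n y) (existT _ m x) nm.
    by move=> /andP[_ /lt_le_trans/(_ up)]; rewrite ltr_pM2l // => /ltW/le_trans; apply.
  + subst n; rewrite tagged_asE same => /andP[/DP + _].
    rewrite natrX => kl; rewrite -[leLHS]ger0_norm ?ler0n // -sqrtr_sqr.
    exact: ler_wsqrtr.
Qed.

End BoxEmbedding.

Theorem corollary15 (R : realType) (F Gamma C : groupType)
    (i : {multiplicative F -> Gamma}) (p : {multiplicative Gamma -> C})
    (F_free : free_group F) (F_fg : finitely_generated F)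
    (C_cyclic : cyclic_group C) (exact_ip : short_exact i p) :
  finitely_generated Gamma /\
  exists K : nat -> normalSubgroup Gamma,
    box_sequence K /\
    forall S : seq Gamma, generates S ->
    forall D : nat -> R, admissible_gaps S K D ->
      coarsely_embeds (@box_dist R Gamma S K D) (@ell2_dist R).
Proof.
have [I [b basis]] := free_fg_basis F_free F_fg.
have [c cC] := C_cyclic.
have [t pt] : exists t, p t = c.
  have [_ _ p_onto] := exact_ip.
  have : range p c by rewrite p_onto.
  by case=> t _ <-; exists t.
split; first exact: (extension_fg exact_ip basis cC pt).
have [K [K_nested K_index K_i K_sep]] := exists_box_subgroups exact_ip basis cC pt.
have K_finite n : finite_set [set: quotient (K n)] by exact: finite_index_quotient.
exists K; split.
  split=> // x Kx.
  have [|px] := pselect (p x = 1%g); last first.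
    by have [n0 /(_ n0 x (leqnn _) (Kx _))] := K_sep _ px.
  move=> /(ker_p exact_ip)[f xf]; rewrite xf (mod2_series_cap basis (x := f)) ?mult1 //.
  by move=> n; apply: mod2_series_decr; apply/K_i; rewrite -xf.
move=> S genS D gapD.
have [k [k_euclidean k_upper k_lower]] :
    exists k : forall n, quotient (K n) -> quotient (K n) -> R,
    [/\ forall n, euclidean (k n),
        forall n a b, k n a b <= level_dist R S a b ^+ 2
      & forall m : nat, exists D : R, forall n (a b : quotient (K n)),
          D < level_dist R S a b -> m%:R <= k n a b].
  apply: exists_level_kernels => // delta delta_gt0.
  have [n0 [r scale]] :=
    exists_scale_kernel exact_ip basis cC pt K_index K_i K_sep genS delta_gt0.
  exists n0, r => n /scale[k [k_eucl k_inv k_step k_far]].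
  exact: (descend_kernel genS k_eucl k_inv k_step k_far).
apply: box_coarsely_embeds k_euclidean k_upper k_lower => //.
by move=> n x y; exact: level_dist_diam.
Qed.
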